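(* Let $n=2m$ with $m\geq2$ an integer. Let $\alpha$ be an $n$-dimensional Riemannian metric of constant sectional curvature $\mu$, expressed locally as $$\alpha^2=\frac{1}{1-\mu r^2}\,\mathrm{d}r^2+r^2(\sigma_1^2+\sigma_2^2+\cdots+\sigma_{n-1}^2),$$ and let $\beta=ar^2\sigma_1$ ($a\neq0$ a constant) be a Killing form of $\alpha$ satisfying $$t_{00}+(a^2-\mu b^2)\alpha^2+\mu(b^2\alpha^2-\beta^2)-\frac{\mu}{a^2-\mu b^2}s_0^2=0.$$ Let $\bar\alpha=e^{\rho(b^2)}\sqrt{\alpha^2-\kappa(b^2)\beta^2}$. Then $\bar\alpha$ has constant Ricci curvature $\bar\mu$ if and only if, after a suitable reparametrization of the variable $r$, $\bar\alpha$ can be expressed as $$\bar\alpha^2=a^4r^4f^2(a^2r^2)\,\mathrm{d}r^2+\frac{1}{1+Ea^2r^2}\cdot\frac{1}{a^4r^2f^2(a^2r^2)}\,\sigma_1^2+r^2(\sigma_2^2+\cdots+\sigma_{n-1}^2),$$ where $E$ and $F$ are constants and $f$ is given by $$f(\varrho)=\pm\frac{1}{\sqrt{F\varrho^{2-m}+\varrho^2-\frac{2m-1}{2m+2}\cdot\frac{\bar\mu}{a^2}\varrho^3}}$$ when $E=0$, and by $$f(\varrho)=\pm\frac{\varrho^{\frac{m-2}{2}}}{\sqrt{F\iota^3-E^{-m-1}\iota^2\left\{\frac{\bar\mu}{a^2}\iota^{2m}+\sum\limits_{k=0}^{m-1}\frac{(-1)^{m-k}}{2k-1}\binom{m}{k}\left[2(m-k)E+(2m-1)\frac{\bar\mu}{a^2}\right]\iota^{2k}\right\}}},\qquad\iota:=\sqrt{1+E\varrho},$$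 when $E\neq0$.
   Context: Setting: $\alpha=\sqrt{a_{ij}(x)y^iy^j}$ is a Riemannian metric (viewed as a function of tangent vectors $y$), $\beta=b_i(x)y^i$ is a 1-form, $b:=\|\beta\|_\alpha$ (here $b^2=a^2r^2$). The $\sigma_i$ are local 1-forms on the unit sphere $\mathbb S^{n-1}$ (not involving $r$) with $\sigma_1^2+\cdots+\sigma_{n-1}^2$ the round metric, so that $\mathrm dr^2+r^2(\sigma_1^2+\cdots+\sigma_{n-1}^2)$ is the Euclidean metric. A bar ''$|$'' denotes covariant derivative with respect to the Levi-Civita connection of $\alpha$; indices are raised and lowered with $a_{ij}$. A 1-form is a Killing form if its dual vector field is Killing, i.e. $b_{i|j}+b_{j|i}=0$. Put $s_{ij}:=\frac12(b_{i|j}-b_{j|i})$, $s_i:=b^ms_{mi}$, $s_0:=s_iy^i$, $t_{ij}:=s_{im}s^m{}_j$, $t_{00}:=t_{ij}y^iy^j$. At points where $a^2-\mu b^2=0$ the term $s_0^2/(a^2-\mu b^2)$ is understood as its limit. Deformation: $\rho,\kappa$ are smooth functions of the single variable $b^2$, and $\Delta:=1-b^2\kappa$ is assumed positive (so that $\bar\alpha$ is a Riemannian metric). All expressions are local, on regions where $r>0$ and the quantities under square roots are positive. Constant Ricci curvature $\bar\mu$ means that the Ricci tensor of $\bar\alpha$ equals $(n-1)\bar\mu$ times the metric $\bar\alpha^2$.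
   Formalization: The formal statement also assumes that e^ρ(a²r²)·r has nonvanishing derivative in r on the region; at a critical radius of this function (which occurs for some Einstein metrics with E<0, where 1+Eϱ=0) no expression of the displayed form exists, so the ''only if'' fails there. *)

(* Defs.v *)
From HB Require Import structures.
From mathcomp Require Import all_boot all_order all_algebra.
From mathcomp Require Import all_classical all_reals all_analysis.

Set Implicit Arguments.
Unset Strict Implicit.
Unset Printing Implicit Defensive.

Import Order.TTheory GRing.Theory Num.Theory.
Import numFieldNormedType.Exports.

Local Open Scope classical_set_scope.
Local Open Scope ring_scope.

(* Local Riemannian geometry is done in the Cartesian coordinates of an open
   set of R^n. Tangent vectors and 1-forms are row vectors of components, and a
   metric [g] is the field of its Gram matrices. *)

Section Calculus.
Variables (R : realType) (n : nat).
Implicit Types (W : set 'rV[R]_n) (f : 'rV[R]_n -> R).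

Definition partial (i : 'I_n) f (x : 'rV[R]_n) : R := 'D_(delta_mx 0 i) f x.

Definition smooth_on W f : Prop :=
  forall (s : seq 'I_n) (x : 'rV[R]_n), W x ->
    differentiable (foldr partial f s) x.

Definition smooth1_on (D : set R) (h : R -> R) : Prop :=
  forall (k : nat) (t : R), D t -> derivable (derive1n k h) t 1.

End Calculus.

Section Riemannian.
Variables (R : realType) (n : nat).
Implicit Types (W : set 'rV[R]_n) (g : 'rV[R]_n -> 'M[R]_n).
Implicit Types (b : 'rV[R]_n -> 'rV[R]_n) (x u v w y : 'rV[R]_n).
Implicit Types (i j k l : 'I_n).

Definition inner g x u v : R := (u *m g x *m v^T) 0 0.

Definition riemannian W g : Prop :=
  [/\ forall i j, smooth_on W (fun x => g x i j),
      forall x, W x -> (g x)^T = g x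
    & forall x, W x -> forall y, y != 0 -> 0 < inner g x y y].

(* Gamma^k_ij *)
Definition christoffel g k i j x : R :=
  2^-1 * \sum_l invmx (g x) k l *
    (partial i (fun z => g z j l) x + partial j (fun z => g z i l) x
     - partial l (fun z => g z i j) x).

(* R(e_i, e_j) e_k = \sum_l (riemann g l k i j) e_l, where
   R(X, Y) = [nabla_X, nabla_Y] - nabla_[X, Y] *)
Definition riemann g l k i j x : R :=
  partial i (christoffel g l j k) x - partial j (christoffel g l i k) x
  + \sum_(p < n) (christoffel g l i p x * christoffel g p j k x
                  - christoffel g l j p x * christoffel g p i k x).

Definition curvature g x u v w : 'rV[R]_n :=
  \row_l \sum_i \sum_j \sum_k riemann g l k i j x * u 0 i * v 0 j * w 0 k.

Definition sectional g x u v : R :=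
  inner g x (curvature g x u v v) u
  / (inner g x u u * inner g x v v - inner g x u v ^+ 2).

Definition constant_sectional W g (mu : R) : Prop :=
  forall x, W x -> forall u v, row_free (col_mx u v) -> sectional g x u v = mu.

Definition ricci g j k x : R := \sum_i riemann g i k i j x.

Definition constant_ricci W g (mu : R) : Prop :=
  forall x, W x -> forall i j, ricci g i j x = n.-1%:R * mu * g x i j.

(* b_{i|j} *)
Definition covd g b i j x : R :=
  partial j (fun z => b z 0 i) x - \sum_k christoffel g k i j x * b x 0 k.

Definition killing W g b : Prop :=
  forall x, W x -> forall i j, covd g b i j x + covd g b j i x = 0.

Definition sqnorm g b x : R := (b x *m invmx (g x) *m (b x)^T) 0 0.

Definition s_ g b i j x : R := 2^-1 * (covd g b i j x - covd g b j i x).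

(* s_i = b^k s_ki *)
Definition s1 g b i x : R :=
  \sum_k (b x *m invmx (g x)) 0 k * s_ g b k i x.

Definition s0 g b x y : R := \sum_i s1 g b i x * y 0 i.

(* t_ij = s_ik s^k_j = s_ik a^kl s_lj *)
Definition t_ g b i j x : R :=
  \sum_k \sum_l s_ g b i k x * invmx (g x) k l * s_ g b l j x.

Definition t00 g b x y : R := \sum_i \sum_j t_ g b i j x * y 0 i * y 0 j.

(* The value of a 1-form with components [w] on the vector [y]. *)
Definition ev w y : R := (w *m y^T) 0 0.

(* The symmetric tensor w (x) w, i.e. the quadratic form y |-> (ev w y)^2. *)
Definition sq w : 'M[R]_n := w^T *m w.

End Riemannian.

Section Polar.
Variables (R : realType) (n : nat).
Implicit Types (W : set 'rV[R]_n) (sg : nat -> 'rV[R]_n -> 'rV[R]_n).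
Implicit Types (x w v : 'rV[R]_n).

(* The Euclidean norm; the library norm of 'rV[R]_n is the sup norm. *)
Definition eradius x : R := Num.sqrt (\sum_i x 0 i ^+ 2).

Definition direction x : 'rV[R]_n := (eradius x)^-1 *: x.

Definition region W : Prop := [/\ open W, connected W, W !=set0 & ~ W 0].

(* The components of the 1-form dr. *)
Definition dr x : 'rV[R]_n := direction x.

(* [sg k w] are the components of the sphere 1-form sigma_k at the unit vector
   [w], extended by 0 to the normal direction; [sigma sg k] is its pull-back
   along x |-> direction x, so it does not involve r. *)
Definition sigma sg (k : nat) x : 'rV[R]_n :=
  (eradius x)^-1 *: sg k (direction x).

(* On the part of the unit sphere below [W], sigma_1, ..., sigma_(n-1) are
   smooth 1-forms whose squares add up to the round metric. *)
Definition sphere_coframe W sg : Prop :=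
  [/\ forall k i, (1 <= k < n)%N -> smooth_on W (fun x => sigma sg k x 0 i),
      forall w, (direction @` W) w ->
        forall k, (1 <= k < n)%N -> ev (sg k w) w = 0
    & forall w, (direction @` W) w -> forall v, ev w v = 0 ->
        \sum_(1 <= k < n) ev (sg k w) v ^+ 2 = ev v v].

End Polar.

(* A change of the radial variable. On the (connected) set of radii of a region
   it is strictly monotone, so it is a diffeomorphism onto its image. *)
Definition reparametrization (R : realType) (I : set R) (phi : R -> R) : Prop :=
  smooth1_on I phi /\ forall r, I r -> 0 < phi r /\ derive1 phi r != 0.

Section RadialFunction.
Variables (R : realType) (m : nat) (a mubar E F : R).

Definition radicand0 (q : R) : R :=
  F * q ^ (2 - m%:Z) + q ^+ 2
  - (2 * m%:R - 1) / (2 * m%:R + 2) * (mubar / a ^+ 2) * q ^+ 3.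

Definition radicandE (q : R) : R :=
  let i := Num.sqrt (1 + E * q) in
  F * i ^+ 3 - E ^- m.+1 * i ^+ 2 *
    (mubar / a ^+ 2 * i ^+ (2 * m)
     + \sum_(0 <= k < m) (-1) ^+ (m - k) / (2 * k%:R - 1) * 'C(m, k)%:R *
         (2 * (m - k)%:R * E + (2 * m%:R - 1) * (mubar / a ^+ 2))
         * i ^+ (2 * k)).

Definition radicand (q : R) : R :=
  if E == 0 then radicand0 q else radicandE q.

(* [e] is the sign +1 or -1 of f. *)
Definition radial_f (e q : R) : R :=
  if E == 0 then e / Num.sqrt (radicand0 q)
  else e * powR q ((m%:R - 2) / 2) / Num.sqrt (radicandE q).

End RadialFunction.

(* Main.v *)
(** The Killing form has Euclidean components with [beta(x).x = 0], and the
    Christoffel symbols of [alpha] annihilate it, so it is a Killing field of the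
    flat metric; being orthogonal to [x] it is linear, [beta = a (J x)^T], and
    [|beta|^2 = a^2 |x|^2] makes [J] a complex structure. Hence
    [alphabar^2 = P |dx|^2 + Q (x.dx)^2 + S (Jx.dx)^2] with [P], [Q], [S] functions
    of [t = |x|^2], and its Ricci tensor has the same shape.

    Write [s = t P] for the coefficient of [sigma_2^2 + ... + sigma_(n-1)^2],
    [H = t (P + t S)] for that of [sigma_1^2], and [G = (ds/dt)^2 / (V U)] with
    [V = P + t Q], [U = P + t S]. Equality of the Ricci curvatures in the
    directions [dr] and [sigma_1] is [dG/ds = (G - 1)/s], so [G = 1 + E a^2 s]; this
    relates the coefficients of [dr^2] and [sigma_1^2]. The equation in the
    directions [sigma_2], ..., [sigma_(n-1)] is then a linear first order equation
    for [H] as a function of [s], whose solutions are the stated [f], with [F] the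
    constant of integration. The remaining radial equation follows from these two
    by differentiation (the contracted Bianchi identity). *)

Require Import Defs.
From HB Require Import structures.
From mathcomp Require Import all_boot all_order all_algebra ring lra zify.
From mathcomp Require Import all_classical all_reals all_analysis.

Set Implicit Arguments.
Unset Strict Implicit.
Unset Printing Implicit Defensive.

Import Order.TTheory GRing.Theory Num.Theory.
Import numFieldNormedType.Exports.

Local Open Scope classical_set_scope.
Local Open Scope ring_scope.

(** * Directional derivatives *)

(** The complex structure [J] is only local: [W] is connected but need not be convex, and linearity
    of the Killing form is proved on a ball. The coefficients [P], [Q], [S], however, are global
    functions of t = |x|^2, and J drops out of the Ricci equations because the tensors 1, [sq x] and
    [sq (rotation J x)] are independent in dimension above two. So the differential equations, and
    with them E and F, live on the whole interval of squared radii. Working in t rather than r gives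
    dt = 2 x.dx and needs no moving frame.

    The braces in the formula for f arise as follows. Put q = a^2 s, K = a^2 H, c = mubar/a^2, v = 1
    + E q and Y = K q^(m-1). For E != 0 the horizontal equation becomes 2 v dY/dv - Y = E^(-m-1)
    (v-1)^(m-1) (2 m E - (2m-1) c (v-1)). The homogeneous solution sqrt v carries F. The operator on
    the left multiplies v^k by 2k - 1; expanding the right side by the binomial theorem and dividing
    by these odd numbers gives the sum. Finally f is read off from K = 1/(v q f^2). *)

Section DerivativeRules.
Variables (R : realType) (V : normedModType R).
Implicit Types (f g : V -> R) (x v : V).

Lemma is_derive_const (c : R) x v : is_derive x v (fun=> c) 0.
Proof. exact: is_derive_cst. Qed.

Lemma is_derive_add f g x v df dg : is_derive x v f df -> is_derive x v g dg ->
  is_derive x v (fun y => f y + g y) (df + dg).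
Proof. by move=> ? ?; exact: is_deriveD. Qed.

Lemma is_derive_opp f x v df : is_derive x v f df -> is_derive x v (fun y => - f y) (- df).
Proof. by move=> ?; exact: is_deriveN. Qed.

Lemma is_derive_sub f g x v df dg : is_derive x v f df -> is_derive x v g dg ->
  is_derive x v (fun y => f y - g y) (df - dg).
Proof. by move=> ? ?; exact: is_deriveB. Qed.

Lemma is_derive_mul f g x v df dg : is_derive x v f df -> is_derive x v g dg ->
  is_derive x v (fun y => f y * g y) (df * g x + f x * dg).
Proof.
move=> hf hg; apply: (is_derive_eq (is_deriveM hf hg)).
by rewrite /GRing.scale /=; ring.
Qed.

Lemma is_derive_expn f n x v df : is_derive x v f df ->
  is_derive x v (fun y => f y ^+ n) (n%:R * f x ^+ n.-1 * df).
Proof.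
move=> hf; have -> : (fun y => f y ^+ n) = f ^+ n.
  by apply/funext => y; rewrite fctE.
case: n => [|n]; first by rewrite expr0 !mul0r; exact: is_derive_cst.
apply: (is_derive_eq (is_deriveX _ hf)).
by rewrite /GRing.scale /= -mulr_natl; ring.
Qed.

Lemma is_derive_bigsum n (h : 'I_n -> V -> R) x v dh :
  (forall i, is_derive x v (h i) (dh i)) ->
  is_derive x v (fun y => \sum_i h i y) (\sum_i dh i).
Proof.
move=> hh; have -> : (fun y => \sum_i h i y) = \sum_i h i.
  by apply/funext => y; rewrite fct_sumE.
exact: is_derive_sum.
Qed.

(** Restriction to the line through [x] makes a directional derivative an ordinary one, so that the
    chain rule below reduces to one real variable. *)
Lemma is_derive_along f x v df : is_derive x v f df <->
  is_derive (0 : R) 1 (fun s : R => f (s *: v + x)) df.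
Proof.
have e : 'D_v f x = 'D_1 (fun s : R => f (s *: v + x)) 0.
  rewrite /derive; set F := fun h : R => h^-1 *: _; set G := fun h : R => h^-1 *: _.
  suff -> : F = G by [].
  by apply/funext => s; rewrite /F /G /= !addr0 scale0r add0r /GRing.scale /= mulr1.
split=> -[d <-]; rewrite ?e.
  exact: (DeriveDef ((derivable1P f x v).1 d) erefl).
by rewrite -e; exact: (DeriveDef ((derivable1P f x v).2 d) erefl).
Qed.

Lemma is_derive_comp f (h : R -> R) x v df dh : is_derive x v f df ->
  is_derive (f x) 1 h dh -> is_derive x v (fun y => h (f y)) (dh * df).
Proof.
move=> hf hh.
apply/is_derive_along.
apply: (is_derive1_comp (f := h) (g := fun s : R => f (s *: v + x))).
  by rewrite scale0r add0r.
exact/is_derive_along.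
Qed.

Lemma is_derive_inv f x v df : f x != 0 -> is_derive x v f df ->
  is_derive x v (fun y => (f y)^-1) (- df / f x ^+ 2).
Proof.
move=> f0 hf; apply: is_derive_eq.
  apply: (is_derive_comp (h := GRing.inv) hf).
  exact: (@is_deriveV R id (f x) 1 1).
by rewrite /GRing.scale /=; ring.
Qed.

Lemma is_derive_near (O : set V) f g x v df : open O -> O x ->
  (forall y, O y -> f y = g y) -> is_derive x v g df -> is_derive x v f df.
Proof.
move=> oO Ox fg; apply: near_eq_is_derive.
by near=> y; apply/esym/fg; near: y; exact: open_nbhs_nbhs.
Unshelve. all: by end_near. Qed.

Lemma is_derive_vanishing (O : set V) f x v df : open O -> O x ->
  (forall y, O y -> f y = 0) -> is_derive x v f df -> df = 0.
Proof.
move=> oO Ox f0 h; rewrite -(@derive_val _ _ _ _ _ _ _ h).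
by apply: derive_val; apply: is_derive_near oO Ox f0 (is_derive_const _ _ _).
Qed.

End DerivativeRules.

Section Coordinates.
Variables (R : realType) (n : nat).
Implicit Types (x v : 'rV[R]_n).

Lemma is_derive_coord i x v : is_derive x v (fun y : 'rV[R]_n => y 0 i) (v 0 i).
Proof.
apply/is_derive_along.
have -> : (fun s : R => (s *: v + x) 0 i) = (fun s : R => s * v 0 i + x 0 i).
  by apply/funext => s; rewrite !mxE.
apply: (is_derive_eq (is_derive_add
  (is_derive_mul (is_derive_id _ _) (is_derive_const _ _ _)) (is_derive_const _ _ _))).
by ring.
Qed.
End Coordinates.

(** * The metrics P |dx|^2 + Q (x.dx)^2 + S (Jx.dx)^2 *)

Section RadialMetric.
Variables (R : realType) (n : nat) (J : 'M[R]_n).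
Implicit Types (x : 'rV[R]_n) (i j k l : 'I_n).

Definition sqradius x : R := \sum_i x 0 i ^+ 2.

Definition rotation x : 'rV[R]_n := x *m J^T.

Definition radial_metric (P Q S : R -> R) x : 'M[R]_n :=
  (P (sqradius x))%:M + Q (sqradius x) *: sq x + S (sqradius x) *: sq (rotation x).

Local Notation dl i j := ((i == j)%:R : R).

Lemma sqE (x : 'rV[R]_n) i j : sq x i j = x 0 i * x 0 j.
Proof. by rewrite !mxE big_ord1 !mxE. Qed.

Lemma rotE x i : rotation x 0 i = \sum_j J i j * x 0 j.
Proof. by rewrite mxE; apply: eq_bigr => j _; rewrite !mxE mulrC. Qed.

Lemma sum_deltal (f : 'I_n -> R) i : \sum_j dl i j * f j = f i.
Proof.
rewrite (bigD1 i) //= eqxx mul1r big1 ?addr0 // => j ji.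
by rewrite eq_sym (negbTE ji) mul0r.
Qed.

Lemma sum_deltar (f : 'I_n -> R) i : \sum_j dl j i * f j = f i.
Proof. by under eq_bigr do rewrite eq_sym; exact: sum_deltal. Qed.

Lemma sum_delta_rr (f : 'I_n -> R) i : \sum_j f j * dl j i = f i.
Proof. by under eq_bigr do rewrite mulrC; exact: sum_deltar. Qed.

Lemma sum_delta_rl (f : 'I_n -> R) i : \sum_j f j * dl i j = f i.
Proof. by under eq_bigr do rewrite mulrC; exact: sum_deltal. Qed.

Lemma is_derive_coord_delta x i k :
  is_derive x (delta_mx 0 k) (fun y : 'rV[R]_n => y 0 i) (dl i k).
Proof. by apply: is_derive_eq; [exact: is_derive_coord | rewrite mxE eqxx]. Qed.

Lemma is_derive_sqradius x k : is_derive x (delta_mx 0 k) sqradius (2 * x 0 k).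
Proof.
apply: is_derive_eq.
  by apply: is_derive_bigsum => i; exact: (is_derive_expn _ (is_derive_coord_delta x i k)).
under eq_bigr do rewrite /= expr1; exact: sum_delta_rr.
Qed.

Lemma is_derive_rot x i k : is_derive x (delta_mx 0 k) (fun y => rotation y 0 i) (J i k).
Proof.
have -> : (fun y => rotation y 0 i) = (fun y => \sum_j J i j * y 0 j).
  by apply/funext => y; exact: rotE.
apply: is_derive_eq.
  by apply: is_derive_bigsum => j; apply: is_derive_mul; exact: is_derive_coord_delta.
under eq_bigr do rewrite mul0r add0r; exact: sum_delta_rr.
Qed.

Lemma is_derive_radial (P : R -> R) p x k : is_derive (sqradius x) 1 P p ->
  is_derive x (delta_mx 0 k) (fun y => P (sqradius y)) (p * (2 * x 0 k)).
Proof. by move=> h; apply: is_derive_comp h; exact: is_derive_sqradius. Qed.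

Lemma radial_metricE P Q S x i j : radial_metric P Q S x i j =
  P (sqradius x) * dl i j + Q (sqradius x) * (x 0 i * x 0 j) +
  S (sqradius x) * (rotation x 0 i * rotation x 0 j).
Proof. by rewrite -!sqE /radial_metric !mxE mulr_natr. Qed.

Lemma is_derive_radial_metric P Q S P1 Q1 S1 x k i j :
  is_derive (sqradius x) 1 P P1 -> is_derive (sqradius x) 1 Q Q1 ->
  is_derive (sqradius x) 1 S S1 ->
  is_derive x (delta_mx 0 k) (fun y => radial_metric P Q S y i j)
   (2 * x 0 k * P1 * dl i j + 2 * x 0 k * Q1 * (x 0 i * x 0 j)
    + Q (sqradius x) * (dl i k * x 0 j + x 0 i * dl j k)
    + 2 * x 0 k * S1 * (rotation x 0 i * rotation x 0 j)
    + S (sqradius x) * (J i k * rotation x 0 j + rotation x 0 i * J j k)).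
Proof.
move=> dP dQ dS0.
under eq_fun do rewrite radial_metricE.
apply: is_derive_eq.
  apply: is_derive_add; first apply: is_derive_add.
  - by apply: is_derive_mul; exact: is_derive_radial dP.
  - apply: is_derive_mul; first exact: is_derive_radial dQ.
    by apply: is_derive_mul; exact: is_derive_coord_delta.
  - apply: is_derive_mul; first exact: is_derive_radial dS0.
    by apply: is_derive_mul; exact: is_derive_rot.
by move=> /=; ring.
Qed.

(** Twice the Christoffel symbols of the first kind. Besides the deformed metric, this serves
    [alpha] itself, with [J] = 0. *)
Lemma lowered_christoffel (O : set 'rV[R]_n) g P Q S P1 Q1 S1 x i j l :
  J^T = - J -> open O -> O x -> (forall y, O y -> g y = radial_metric P Q S y) ->
  is_derive (sqradius x) 1 P P1 -> is_derive (sqradius x) 1 Q Q1 ->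
  is_derive (sqradius x) 1 S S1 ->
  let t := sqradius x in let w := rotation x in
  partial i (fun z => g z j l) x + partial j (fun z => g z i l) x
     - partial l (fun z => g z i j) x =
  2 * (P1 * (x 0 i * dl j l + x 0 j * dl i l) + (Q t - P1) * dl i j * x 0 l
   + Q1 * x 0 i * x 0 j * x 0 l
   + S1 * (x 0 i * w 0 j + x 0 j * w 0 i) * w 0 l - S1 * x 0 l * w 0 i * w 0 j
   + S t * (J l i * w 0 j + J l j * w 0 i)).
Proof.
move=> skew oO Ox gE dP dQ dS0 t w.
have gE' a b y : O y -> g y a b = radial_metric P Q S y a b by move=> /gE ->.
have pE k a b := @derive_val _ _ _ _ _ _ _
  (is_derive_near oO Ox (gE' a b) (is_derive_radial_metric k a b dP dQ dS0)).
rewrite /partial !pE.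
have sk a b : J a b = - J b a.
  by move/matrixP/(_ b a): skew; rewrite !mxE.
rewrite (sk i j) (sk i l) (sk j l) (eq_sym l i) (eq_sym l j) (eq_sym j i).
by rewrite -/t -/w; ring.
Qed.
End RadialMetric.

(** * Inverse and Christoffel symbols of a radial metric *)

Section ComplexStructure.
Variables (R : realType) (n : nat) (J : 'M[R]_n).
Hypotheses (skew : J^T = - J) (orth : J *m J^T = 1%:M).
Implicit Types (x : 'rV[R]_n) (i j k l : 'I_n).
Local Notation dl i j := ((i == j)%:R : R).
Local Notation rot := (rotation J).

Lemma skewE i j : J i j = - J j i.
Proof. by move/matrixP/(_ j i): skew; rewrite !mxE. Qed.

Lemma skew_diag i : J i i = 0.
Proof. by have := skewE i i; lra. Qed.

Lemma sqr_complex : J *m J = - 1%:M.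
Proof. by rewrite -orth skew mulmxN opprK. Qed.

Lemma rot_rot x : rot (rot x) = - x.
Proof.
by rewrite /rotation -mulmxA -trmx_mul sqr_complex linearN /= trmx1 mulmxN mulmx1.
Qed.

Lemma dotE (u v : 'rV[R]_n) : (u *m v^T) = (\sum_i u 0 i * v 0 i)%:M.
Proof.
apply/matrixP => a b; rewrite !ord1 !mxE mulr1n.
by apply: eq_bigr => i _; rewrite !mxE.
Qed.

Lemma dot_xx x : \sum_i x 0 i * x 0 i = sqradius x.
Proof. by apply: eq_bigr => i _; rewrite expr2. Qed.

Lemma dotC (u v : 'rV[R]_n) : \sum_i u 0 i * v 0 i = \sum_i v 0 i * u 0 i.
Proof. by apply: eq_bigr => i _; rewrite mulrC. Qed.

Lemma dot_adj (u v : 'rV[R]_n) :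
  \sum_i rot u 0 i * v 0 i = - \sum_i u 0 i * rot v 0 i.
Proof.
have := dotE (rot u) v; rewrite /rotation -mulmxA -[J^T *m _]trmxK trmx_mul !trmxK.
have -> : (v *m J)^T = - (rot v)^T.
  by rewrite /rotation skew mulmxN linearN /= opprK.
rewrite mulmxN dotE => /matrixP/(_ 0 0); rewrite !mxE !mulr1n => <-.
by [].
Qed.

Lemma dot_wx x : \sum_i rot x 0 i * x 0 i = 0.
Proof. by have := dot_adj x x; rewrite (dotC x); lra. Qed.

Lemma dot_xw x : \sum_i x 0 i * rot x 0 i = 0.
Proof. by rewrite dotC dot_wx. Qed.

Lemma dot_ww x : \sum_i rot x 0 i * rot x 0 i = sqradius x.
Proof.
rewrite dot_adj rot_rot -dot_xx -sumrN.
by apply: eq_bigr => i _; rewrite !mxE; ring.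
Qed.

Lemma dot_Jx x i : \sum_j J i j * x 0 j = rot x 0 i.
Proof. by rewrite rotE. Qed.

Lemma dot_xJ x j : \sum_i x 0 i * J i j = - rot x 0 j.
Proof.
by rewrite rotE -sumrN; apply: eq_bigr => i _; rewrite skewE; ring.
Qed.

Lemma dot_Jw x i : \sum_j J i j * rot x 0 j = - x 0 i.
Proof. by rewrite -rotE rot_rot mxE. Qed.

Lemma dot_wJ x j : \sum_i rot x 0 i * J i j = x 0 j.
Proof. by rewrite dot_xJ rot_rot mxE opprK. Qed.

Lemma dot_JJ i j : \sum_p J i p * J p j = - dl i j.
Proof. by move/matrixP/(_ i j): sqr_complex; rewrite !mxE. Qed.

Lemma sq_mul (u v : 'rV[R]_n) :
  sq u *m sq v = (\sum_i u 0 i * v 0 i) *: (u^T *m v).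
Proof. by rewrite /sq mulmxA -(mulmxA u^T) dotE mul_mx_scalar -scalemxAl. Qed.

(** [x] and [rot x] are orthogonal of squared length t, so the metric has eigenvalues V = P + tQ on
    [x], U = P + tS on [rot x], and P on the rest. The coefficients are (1/V - 1/P)/t and (1/U -
    1/P)/t. *)
Lemma invmx_radial_metric (P Q S : R -> R) x (t := sqradius x) :
  P t != 0 -> P t + t * Q t != 0 -> P t + t * S t != 0 ->
  invmx (radial_metric J P Q S x) = (P t)^-1%:M
    - (Q t / (P t * (P t + t * Q t))) *: sq x
    - (S t / (P t * (P t + t * S t))) *: sq (rot x).
Proof.
move=> p0 v0 u0; set B := RHS.
suff AB : radial_metric J P Q S x *m B = 1%:M.
  have [uA _] := mulmx1_unit AB.
  by rewrite -[LHS]mulmx1 -AB mulmxA mulVmx // mul1mx.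
rewrite /radial_metric /B -/t !mulmxDl !mulmxBr !mul_scalar_mx !mul_mx_scalar.
rewrite -!scalemxAl -!scalemxAr !sq_mul dot_xx dot_xw dot_wx dot_ww.
rewrite -/t !scale0r -/(sq x) -/(sq (rot x)).
move: (sq x) (sq (rot x)) => X Y; apply/matrixP => a b; rewrite !mxE.
move: (P t) (Q t) (S t) p0 v0 u0 => p q s p0 v0 u0.
by case: (a == b); rewrite ?mulr1n ?mulr0n; field; rewrite ?p0 ?v0 ?u0.
Qed.


(* The index [k] is the upper one. *)
Definition radial_connection (c1 c2 c3 c4 c5 c6 : R) x k i j : R :=
  c1 * (x 0 i * dl j k + x 0 j * dl i k) + c2 * dl i j * x 0 k
  + c3 * x 0 i * x 0 j * x 0 k
  + c4 * (x 0 i * rot x 0 j + x 0 j * rot x 0 i) * rot x 0 k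
  + c5 * rot x 0 i * rot x 0 j * x 0 k
  + c6 * (J k i * rot x 0 j + J k j * rot x 0 i).

Lemma sum_lin x (h : 'I_n -> R) A B C D E F i j :
  \sum_l h l * (A * x 0 l + B * rot x 0 l + C * dl i l + D * dl j l
    + E * J l i + F * J l j) =
  A * (\sum_l h l * x 0 l) + B * (\sum_l h l * rot x 0 l) + C * h i + D * h j
    + E * (\sum_l h l * J l i) + F * (\sum_l h l * J l j).
Proof.
rewrite -[in RHS](sum_delta_rl h i) -[in RHS](sum_delta_rl h j).
rewrite !mulr_sumr -!big_split; apply: eq_bigr => l _ /=; ring.
Qed.

(** Raising the index divides by V along [x], by U along [rot x] and by P elsewhere. The terms in
    [dl] and [J] also have components along [x] and [rot x], which produce the denominators P V and
    P U. *)
Lemma christoffel_radial (O : set 'rV[R]_n) g (P Q S : R -> R) P1 Q1 S1 x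
    (t := sqradius x) (V := P t + t * Q t) (U := P t + t * S t) k i j :
  open O -> O x -> (forall y, O y -> g y = radial_metric J P Q S y) ->
  is_derive (sqradius x) 1 P P1 -> is_derive (sqradius x) 1 Q Q1 ->
  is_derive (sqradius x) 1 S S1 ->
  P t != 0 -> V != 0 -> U != 0 ->
  christoffel g k i j x = radial_connection (P1 / P t) ((Q t - P1) / V)
    (Q1 / V - 2 * P1 * Q t / (P t * V))
    (S1 / U - (P1 + S t) * S t / (P t * U))
    (- S1 / V + 2 * S t * Q t / (P t * V)) (S t / P t) x k i j.
Proof.
move=> oO Ox gE dP dQ dS0 p0 v0 u0; rewrite /christoffel (gE x Ox).
rewrite (invmx_radial_metric p0 v0 u0) -/t.
have lc l := lowered_christoffel i j l skew oO Ox gE dP dQ dS0.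
transitivity (2^-1 * \sum_l ((P t)^-1%:M
    - (Q t / (P t * (P t + t * Q t))) *: sq x
    - (S t / (P t * (P t + t * S t))) *: sq (rot x)) k l * (2 *
   (P1 * (x 0 i * dl j l + x 0 j * dl i l) + (Q t - P1) * dl i j * x 0 l
   + Q1 * x 0 i * x 0 j * x 0 l
   + S1 * (x 0 i * rot x 0 j + x 0 j * rot x 0 i) * rot x 0 l
   - S1 * x 0 l * rot x 0 i * rot x 0 j
   + S t * (J l i * rot x 0 j + J l j * rot x 0 i)))).
  by congr (_ * _); apply: eq_bigr => l _; congr (_ * _); exact: lc.
clear lc.
set p := (P t)^-1; set q := Q t / _; set s := S t / _.
(* [A] and [B] collect the coefficients of [x 0 l] and [rot x 0 l], which brings the summand into
   the shape of [sum_lin]. *)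
pose A := ((Q t - P1) * dl i j + Q1 * x 0 i * x 0 j - S1 * rot x 0 i * rot x 0 j).
pose B := S1 * (x 0 i * rot x 0 j + x 0 j * rot x 0 i).
pose f l := A * x 0 l + B * rot x 0 l + P1 * x 0 j * dl i l + P1 * x 0 i * dl j l
    + S t * rot x 0 j * J l i + S t * rot x 0 i * J l j.
have -> : \sum_l (p%:M - q *: sq x - s *: sq (rot x)) k l * (2 *
   (P1 * (x 0 i * dl j l + x 0 j * dl i l) + (Q t - P1) * dl i j * x 0 l
   + Q1 * x 0 i * x 0 j * x 0 l
   + S1 * (x 0 i * rot x 0 j + x 0 j * rot x 0 i) * rot x 0 l
   - S1 * x 0 l * rot x 0 i * rot x 0 j
   + S t * (J l i * rot x 0 j + J l j * rot x 0 i))) =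
  2 * p * (\sum_l dl k l * f l) - 2 * q * x 0 k * (\sum_l x 0 l * f l)
   - 2 * s * rot x 0 k * (\sum_l rot x 0 l * f l).
  rewrite !mulr_sumr -!sumrB; apply: eq_bigr => l _.
  have -> : (p%:M - q *: sq x - s *: sq (rot x)) k l =
     p * dl k l - q * (x 0 k * x 0 l) - s * (rot x 0 k * rot x 0 l).
    by rewrite -!sqE; move: (sq x) (sq (rot x)) => X Y; rewrite !mxE mulr_natr.
  by rewrite /f /A /B; ring.
rewrite sum_deltal /f !sum_lin (dot_xx x) (dot_xw x) (dot_wx x) (dot_ww x).
rewrite !(dot_xJ x) !(dot_wJ x) -/t.
rewrite /radial_connection /p /q /s /A /B; move: p0 v0 u0; rewrite /V /U.
move: (P t) (Q t) (S t) => p' q' s' p0 v0 u0.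
by field; rewrite ?p0 ?v0 ?u0.
Qed.
End ComplexStructure.

(** * Contractions of a radial connection and its Ricci tensor *)

Section RadialRicci.
Variables (R : realType) (n : nat) (J : 'M[R]_n).
Hypotheses (skew : J^T = - J) (orth : J *m J^T = 1%:M).
Implicit Types (x : 'rV[R]_n) (i j k l p : 'I_n) (c d : R).
Local Notation dl i j := ((i == j)%:R : R).
Local Notation rot := (rotation J).
Local Notation conn := (radial_connection J).

(** The product rule for [radial_connection] in direction [m]: the [d]s are derivatives in t, and 2
    x_m is the derivative of t. *)
Definition partial_connection c1 c2 c3 c4 c5 c6 d1 d2 d3 d4 d5 d6 x m l a b : R :=
  2 * x 0 m * conn d1 d2 d3 d4 d5 d6 x l a b
  + c1 * (dl a m * dl b l + dl b m * dl a l) + c2 * dl a b * dl l m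
  + c3 * (dl a m * x 0 b * x 0 l + x 0 a * dl b m * x 0 l + x 0 a * x 0 b * dl l m)
  + c4 * (dl a m * rot x 0 b + x 0 a * J b m + dl b m * rot x 0 a + x 0 b * J a m)
      * rot x 0 l
  + c4 * (x 0 a * rot x 0 b + x 0 b * rot x 0 a) * J l m
  + c5 * (J a m * rot x 0 b * x 0 l + rot x 0 a * J b m * x 0 l
      + rot x 0 a * rot x 0 b * dl l m)
  + c6 * (J l a * J b m + J l b * J a m).

Lemma is_derive_conn (c1 c2 c3 c4 c5 c6 : R -> R) d1 d2 d3 d4 d5 d6 x
    (t := sqradius x) m l a b :
  is_derive t 1 c1 d1 -> is_derive t 1 c2 d2 -> is_derive t 1 c3 d3 ->
  is_derive t 1 c4 d4 -> is_derive t 1 c5 d5 -> is_derive t 1 c6 d6 ->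
  is_derive x (delta_mx 0 m) (fun y => let s := sqradius y in
    conn (c1 s) (c2 s) (c3 s) (c4 s) (c5 s) (c6 s) y l a b)
   (partial_connection (c1 t) (c2 t) (c3 t) (c4 t) (c5 t) (c6 t) d1 d2 d3 d4 d5 d6 x m l a b).
Proof.
move=> D1 D2 D3 D4 D5 D6; cbv zeta; rewrite /radial_connection.
have X i := is_derive_coord_delta x i m.
have W i := is_derive_rot J x i m.
have C f df (D : is_derive t 1 f df) := is_derive_radial m D.
move: (C _ _ D1) (C _ _ D2) (C _ _ D3) (C _ _ D4) (C _ _ D5) (C _ _ D6) => {}C1 C2 C3 C4 C5 C6.
apply: is_derive_eq.
by rewrite /partial_connection /radial_connection /GRing.scale /=; ring.
Qed.

Variables (c1 c2 c3 c4 c5 c6 d1 d2 d3 d4 d5 d6 : R).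
Local Notation G := (conn c1 c2 c3 c4 c5 c6).
Local Notation dG := (partial_connection c1 c2 c3 c4 c5 c6 d1 d2 d3 d4 d5 d6).
Let N : R := n%:R.

Lemma sum_conn_upper x h j k : \sum_p h p * G x p j k =
  (c2 * dl j k + c3 * x 0 j * x 0 k + c5 * rot x 0 j * rot x 0 k)
     * (\sum_p h p * x 0 p)
  + c4 * (x 0 j * rot x 0 k + x 0 k * rot x 0 j) * (\sum_p h p * rot x 0 p)
  + c1 * x 0 k * h j + c1 * x 0 j * h k
  + c6 * rot x 0 k * (\sum_p h p * J p j) + c6 * rot x 0 j * (\sum_p h p * J p k).
Proof.
rewrite -(sum_lin J); apply: eq_bigr => p _; rewrite /radial_connection; ring.
Qed.

Lemma sum_conn_lower x h i j : \sum_p G x i j p * h p =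
  c1 * (x 0 j * h i + dl j i * (\sum_p x 0 p * h p)) + c2 * h j * x 0 i
  + c3 * x 0 j * x 0 i * (\sum_p x 0 p * h p)
  + c4 * rot x 0 i * (x 0 j * (\sum_p rot x 0 p * h p)
        + rot x 0 j * (\sum_p x 0 p * h p))
  + c5 * rot x 0 j * x 0 i * (\sum_p rot x 0 p * h p)
  + c6 * (J i j * (\sum_p rot x 0 p * h p) + rot x 0 j * (\sum_p J i p * h p)).
Proof.
under eq_bigr => p _.
  have -> : G x i j p * h p = c1 * x 0 j * (dl i p * h p)
     + c1 * dl j i * (x 0 p * h p) + c2 * x 0 i * (dl j p * h p)
     + c3 * x 0 j * x 0 i * (x 0 p * h p)
     + c4 * rot x 0 i * x 0 j * (rot x 0 p * h p)
     + c4 * rot x 0 i * rot x 0 j * (x 0 p * h p)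
     + c5 * rot x 0 j * x 0 i * (rot x 0 p * h p)
     + c6 * J i j * (rot x 0 p * h p) + c6 * rot x 0 j * (J i p * h p).
    by rewrite /radial_connection (eq_sym i p); ring.
  over.
by rewrite !big_split /= -!mulr_sumr !sum_deltal; ring.
Qed.

Let tau t : R := (N + 1) * c1 + c2 + t * c3 + t * c4 + c6.

(** For a Levi-Civita connection this trace is the differential of log sqrt(det g), a function of t.
    Algebraically, the multiples of [rot x] vanish or combine into [x] because [x] is orthogonal to
    [rot x] and [J] is skew. *)
Lemma conn_trace x k : \sum_i G x i i k = tau (sqradius x) * x 0 k.
Proof.
under eq_bigr => i _.
  have -> : G x i i k = c1 * (x 0 i * dl k i) + c1 * x 0 k * 1 + c2 * (dl i k * x 0 i)
     + c3 * x 0 k * (x 0 i * x 0 i) + c4 * rot x 0 k * (x 0 i * rot x 0 i)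
     + c4 * x 0 k * (rot x 0 i * rot x 0 i) + c5 * rot x 0 k * (rot x 0 i * x 0 i)
     + c6 * (rot x 0 i * J i k).
    by rewrite /radial_connection eqxx mulr1n (skew_diag skew i); ring.
  over.
rewrite !big_split /= -!mulr_sumr sum_delta_rl sum_deltar.
rewrite (dot_xx x) (dot_xw skew x) (dot_ww skew orth x).
rewrite (dot_wx skew x) (dot_wJ skew orth x) sumr_const card_ord.
by rewrite /tau /N -[1 *+ n]/(n%:R); ring.
Qed.

Lemma dconn_divergence x j k (t := sqradius x) : \sum_i dG x i i j k =
  (4 * d1 + 2 * t * d3 + (N + 2) * c3 - 2 * c4) * (x 0 j * x 0 k)
  + (2 * c1 + 2 * t * d2 + N * c2 - 2 * c6) * dl j k
  + (2 * c4 + 2 * t * d5 + (N + 2) * c5 - 4 * d6) * (rot x 0 j * rot x 0 k).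
Proof.
under eq_bigr => i _.
  have -> : dG x i i j k =
     2 * d1 * x 0 j * (x 0 i * dl k i) + 2 * d1 * x 0 k * (x 0 i * dl j i)
     + 2 * c1 * (dl j i * dl k i) + 2 * d2 * dl j k * (x 0 i * x 0 i)
     + c2 * dl j k * 1 + 2 * d3 * x 0 j * x 0 k * (x 0 i * x 0 i)
     + c3 * x 0 k * (x 0 i * dl j i) + c3 * x 0 j * (x 0 i * dl k i)
     + c3 * x 0 j * x 0 k * 1
     + 2 * d4 * (x 0 j * rot x 0 k + x 0 k * rot x 0 j) * (x 0 i * rot x 0 i)
     + c4 * rot x 0 k * (dl j i * rot x 0 i) + c4 * x 0 j * (J k i * rot x 0 i)
     + c4 * rot x 0 j * (dl k i * rot x 0 i) + c4 * x 0 k * (J j i * rot x 0 i)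
     + 2 * d5 * rot x 0 j * rot x 0 k * (x 0 i * x 0 i)
     + c5 * rot x 0 k * (J j i * x 0 i) + c5 * rot x 0 j * (J k i * x 0 i)
     + c5 * rot x 0 j * rot x 0 k * 1
     + 2 * d6 * rot x 0 k * (x 0 i * J i j) + 2 * d6 * rot x 0 j * (x 0 i * J i k)
     + c6 * (J k i * J i j) + c6 * (J j i * J i k).
    by rewrite /partial_connection /radial_connection eqxx mulr1n (skew_diag skew i); ring.
  over.
rewrite !big_split /= -!mulr_sumr !sum_delta_rl !sum_deltal (dot_xx x) (dot_xw skew x).
rewrite !(dot_Jw skew orth x) !(dot_Jx J x) !(dot_xJ skew x) !(dot_JJ skew orth).
rewrite sumr_const card_ord.
by rewrite /N -[1 *+ n]/(n%:R) (eq_sym k j) -/t; ring.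
Qed.

Lemma conn_square x j k (t := sqradius x) :
  \sum_i \sum_p G x i j p * G x p i k =
  (c1 * tau t + c1 * (2 * c1 + t * c3) + c2 * (c1 + c2 + t * c3)
     + c3 * t * (2 * c1 + t * c3 + c2) + (c4 * t + c6) * (c1 + c4 * t + c6))
    * (x 0 j * x 0 k)
  + 2 * c1 * c2 * t * dl j k
  + (c1 * (c5 * t - 2 * c6) + c2 * (c4 * t + c6)
     + c4 * t * (c2 + c5 * t - 2 * c6) + (c5 * t - c6) * (c1 + c4 * t + c6)
     + c6 * (- c1 + c2 - c4 * t + c5 * t - c6 - N * c6)) * (rot x 0 j * rot x 0 k).
Proof.
(* By [sum_conn_upper] the second factor meets the index p only through [x], [rot x], [dl] and [J];
   [a], [b] and [m] are the contractions of the first factor with [x], [rot x] and [J]. *)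
pose a i := (c1 + c2 + t * c3) * x 0 j * x 0 i + c1 * t * dl j i
  + (c4 * t + c6) * rot x 0 j * rot x 0 i.
pose b i := (c1 + c4 * t) * x 0 j * rot x 0 i
  + (c2 + c5 * t - c6) * rot x 0 j * x 0 i + c6 * t * J i j.
pose m q i := c1 * (x 0 j * J i q - dl j i * rot x 0 q) + c2 * J j q * x 0 i
  - c3 * x 0 j * x 0 i * rot x 0 q
  + c4 * rot x 0 i * (x 0 j * x 0 q - rot x 0 j * rot x 0 q)
  + c5 * rot x 0 j * x 0 i * x 0 q + c6 * (J i j * x 0 q - rot x 0 j * dl i q).
have aE i : \sum_p G x i j p * x 0 p = a i.
  by rewrite sum_conn_lower (dot_xx x) (dot_wx skew x) (dot_Jx J x) -/t /a; ring.
have bE i : \sum_p G x i j p * rot x 0 p = b i.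
  rewrite sum_conn_lower (dot_xw skew x) (dot_ww skew orth x) (dot_Jw skew orth x).
  by rewrite -/t /b; ring.
have mE q i : \sum_p G x i j p * J p q = m q i.
  by rewrite sum_conn_lower (dot_xJ skew x) (dot_wJ skew orth x) (dot_JJ skew orth) /m; ring.
under eq_bigr => i _.
  rewrite (sum_conn_upper x (fun p => G x i j p)) aE bE !mE.
  have -> : (c2 * dl i k + c3 * x 0 i * x 0 k + c5 * rot x 0 i * rot x 0 k) * a i
     + c4 * (x 0 i * rot x 0 k + x 0 k * rot x 0 i) * b i
     + c1 * x 0 k * G x i j i + c1 * x 0 i * G x i j k
     + c6 * rot x 0 k * m i i + c6 * rot x 0 i * m k i
     = c2 * (dl i k * a i) + c3 * x 0 k * (x 0 i * a i)
     + c5 * rot x 0 k * (rot x 0 i * a i) + c4 * rot x 0 k * (x 0 i * b i)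
     + c4 * x 0 k * (rot x 0 i * b i) + c1 * x 0 k * G x i i j
     + c1 * (x 0 i * G x i j k) + c6 * rot x 0 k * m i i
     + c6 * (rot x 0 i * m k i).
    (* Symmetry in the lower indices turns this contraction into the trace computed by
       [conn_trace]. *)
    have -> : G x i i j = G x i j i by rewrite /radial_connection (eq_sym j i); ring.
    by ring.
  over.
rewrite !big_split /= -!mulr_sumr sum_deltar conn_trace.
have xa : \sum_i x 0 i * a i = x 0 j * t * (2 * c1 + t * c3 + c2).
  under eq_bigr => i _.
    have -> : x 0 i * a i = (c1 + c2 + t * c3) * x 0 j * (x 0 i * x 0 i)
     + c1 * t * (dl j i * x 0 i) + (c4 * t + c6) * rot x 0 j * (x 0 i * rot x 0 i).
      by rewrite /a; ring.
    over.
  by rewrite !big_split /= -!mulr_sumr sum_deltal (dot_xx x) (dot_xw skew x) -/t; ring.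
have wa : \sum_i rot x 0 i * a i = rot x 0 j * t * (c1 + c4 * t + c6).
  under eq_bigr => i _.
    have -> : rot x 0 i * a i = (c1 + c2 + t * c3) * x 0 j * (rot x 0 i * x 0 i)
     + c1 * t * (dl j i * rot x 0 i)
     + (c4 * t + c6) * rot x 0 j * (rot x 0 i * rot x 0 i).
      by rewrite /a; ring.
    over.
  rewrite !big_split /= -!mulr_sumr sum_deltal (dot_wx skew x) (dot_ww skew orth x).
  by rewrite -/t; ring.
have xb : \sum_i x 0 i * b i = rot x 0 j * t * (c2 + c5 * t - 2 * c6).
  under eq_bigr => i _.
    have -> : x 0 i * b i = (c1 + c4 * t) * x 0 j * (x 0 i * rot x 0 i)
     + (c2 + c5 * t - c6) * rot x 0 j * (x 0 i * x 0 i) + c6 * t * (x 0 i * J i j).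
      by rewrite /b; ring.
    over.
  by rewrite !big_split /= -!mulr_sumr (dot_xx x) (dot_xw skew x) (dot_xJ skew x) -/t; ring.
have wb : \sum_i rot x 0 i * b i = x 0 j * t * (c1 + c4 * t + c6).
  under eq_bigr => i _.
    have -> : rot x 0 i * b i = (c1 + c4 * t) * x 0 j * (rot x 0 i * rot x 0 i)
     + (c2 + c5 * t - c6) * rot x 0 j * (rot x 0 i * x 0 i)
     + c6 * t * (rot x 0 i * J i j).
      by rewrite /b; ring.
    over.
  rewrite !big_split /= -!mulr_sumr (dot_ww skew orth x) (dot_wx skew x).
  by rewrite (dot_wJ skew orth x) -/t; ring.
have mm : \sum_i m i i = rot x 0 j * (- c1 + c2 - c4 * t + c5 * t - c6 - N * c6).
  under eq_bigr => i _.
    have -> : m i i = - c1 * (dl j i * rot x 0 i) + c2 * (J j i * x 0 i)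
     + (c4 * x 0 j - c3 * x 0 j) * (x 0 i * rot x 0 i)
     + (- c4 * rot x 0 j) * (rot x 0 i * rot x 0 i)
     + c5 * rot x 0 j * (x 0 i * x 0 i) + c6 * (x 0 i * J i j)
     + (- c6 * rot x 0 j) * 1.
      by rewrite /m eqxx mulr1n (skew_diag skew i); ring.
    over.
  rewrite !big_split /= -!mulr_sumr sum_deltal (dot_Jx J x) (dot_xw skew x).
  rewrite (dot_ww skew orth x) (dot_xx x).
  by rewrite (dot_xJ skew x) sumr_const card_ord -[1 *+ n]/(n%:R) -/t /N; ring.
have wm : \sum_i rot x 0 i * m k i =
    (c1 + c4 * t + c6) * (x 0 j * x 0 k - rot x 0 j * rot x 0 k).
  under eq_bigr => i _.
    have -> : rot x 0 i * m k i = c1 * x 0 j * (rot x 0 i * J i k)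
     + (- c1 * rot x 0 k) * (dl j i * rot x 0 i)
     + (c2 * J j k - c3 * x 0 j * rot x 0 k + c5 * rot x 0 j * x 0 k)
         * (rot x 0 i * x 0 i)
     + c4 * (x 0 j * x 0 k - rot x 0 j * rot x 0 k) * (rot x 0 i * rot x 0 i)
     + c6 * x 0 k * (rot x 0 i * J i j)
     + (- c6 * rot x 0 j) * (dl i k * rot x 0 i).
      by rewrite /m; ring.
    over.
  rewrite !big_split /= -!mulr_sumr sum_deltal sum_deltar.
  rewrite !(dot_wJ skew orth x) (dot_ww skew orth x).
  by rewrite (dot_wx skew x) -/t; ring.
rewrite xa wa xb wb mm wm sum_conn_upper (dot_xx x) (dot_xw skew x) !(dot_xJ skew x).
by rewrite -/t /a /tau; ring.
Qed.

Lemma conn_radial x j k (t := sqradius x) : \sum_p x 0 p * G x p j k =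
  (2 * c1 + t * c3) * (x 0 j * x 0 k) + c2 * t * dl j k
  + (t * c5 - 2 * c6) * (rot x 0 j * rot x 0 k).
Proof.
by rewrite sum_conn_upper (dot_xx x) (dot_xw skew x) !(dot_xJ skew x) -/t; ring.
Qed.

End RadialRicci.

Section RicciOfConnection.
Variables (R : realType) (n : nat) (J : 'M[R]_n).
Hypotheses (skew : J^T = - J) (orth : J *m J^T = 1%:M).
Implicit Types (x : 'rV[R]_n) (i j k l p : 'I_n).
Local Notation dl i j := ((i == j)%:R : R).
Local Notation rot := (rotation J).

Lemma ricci_conn (O : set 'rV[R]_n) g (c1 c2 c3 c4 c5 c6 : R -> R)
    d1 d2 d3 d4 d5 d6 x j k (t := sqradius x) (N := n%:R : R)
    (tau := (N + 1) * c1 t + c2 t + t * c3 t + t * c4 t + c6 t)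
    (dtau := (N + 1) * d1 + d2 + c3 t + t * d3 + c4 t + t * d4 + d6) :
  open O -> O x ->
  (forall y l a b, O y -> christoffel g l a b y =
     let s := sqradius y in
     radial_connection J (c1 s) (c2 s) (c3 s) (c4 s) (c5 s) (c6 s) y l a b) ->
  is_derive t 1 c1 d1 -> is_derive t 1 c2 d2 -> is_derive t 1 c3 d3 ->
  is_derive t 1 c4 d4 -> is_derive t 1 c5 d5 -> is_derive t 1 c6 d6 ->
  ricci g j k x =
  (2 * c1 t + 2 * t * d2 + N * c2 t - 2 * c6 t - tau + tau * t * c2 t
     - 2 * c1 t * c2 t * t) * dl j k
  + (4 * d1 + 2 * t * d3 + (N + 2) * c3 t - 2 * c4 t - 2 * dtau
     + tau * (2 * c1 t + t * c3 t)
     - (c1 t * tau + c1 t * (2 * c1 t + t * c3 t) + c2 t * (c1 t + c2 t + t * c3 t)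
        + c3 t * t * (2 * c1 t + t * c3 t + c2 t)
        + (c4 t * t + c6 t) * (c1 t + c4 t * t + c6 t))) * (x 0 j * x 0 k)
  + (2 * c4 t + 2 * t * d5 + (N + 2) * c5 t - 4 * d6 + tau * (t * c5 t - 2 * c6 t)
     - (c1 t * (c5 t * t - 2 * c6 t) + c2 t * (c4 t * t + c6 t)
        + c4 t * t * (c2 t + c5 t * t - 2 * c6 t)
        + (c5 t * t - c6 t) * (c1 t + c4 t * t + c6 t)
        + c6 t * (- c1 t + c2 t - c4 t * t + c5 t * t - c6 t - N * c6 t)))
     * (rot x 0 j * rot x 0 k).
Proof.
move=> oO Ox GE D1 D2 D3 D4 D5 D6.
have dE m l a b : partial m (christoffel g l a b) x =
    partial_connection J (c1 t) (c2 t) (c3 t) (c4 t) (c5 t) (c6 t) d1 d2 d3 d4 d5 d6 x m l a b.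
  apply: derive_val; apply: (is_derive_near oO Ox (fun y => GE y l a b)).
  exact: is_derive_conn.
pose G := radial_connection J (c1 t) (c2 t) (c3 t) (c4 t) (c5 t) (c6 t) x.
have GEx l a b : christoffel g l a b x = G l a b by exact: GE.
(* Instead of tracing [partial_connection], differentiate the closed form tau(t) x_k of the trace;
   uniqueness of the derivative identifies the two. *)
have trE : \sum_i partial j (christoffel g i i k) x = 2 * x 0 j * dtau * x 0 k + tau * dl k j.
  pose T s := (N + 1) * c1 s + c2 s + s * c3 s + s * c4 s + c6 s.
  have dT : is_derive t 1 T dtau.
    apply: is_derive_eq; rewrite /dtau /GRing.scale /=; ring.
  pose F y := \sum_i christoffel g i i k y.
  have h1 : is_derive x (delta_mx 0 j) F (\sum_i partial j (christoffel g i i k) x).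
    apply: is_derive_bigsum => i; rewrite dE.
    apply: (is_derive_near oO Ox (fun y => GE y i i k)); exact: is_derive_conn.
  have h2 : is_derive x (delta_mx 0 j) F (2 * x 0 j * dtau * x 0 k + tau * dl k j).
    apply: (is_derive_near (g := fun y => T (sqradius y) * y 0 k) oO Ox).
      move=> y Oy; rewrite -(conn_trace skew orth (c1 (sqradius y)) (c2 (sqradius y))
        (c3 (sqradius y)) (c4 (sqradius y)) (c5 (sqradius y)) (c6 (sqradius y)) y k).
      by apply: eq_bigr => i _; exact: GE.
    apply: is_derive_eq.
      by apply: is_derive_mul; [exact: (is_derive_radial j dT) | exact: is_derive_coord_delta].
    by rewrite /= -/t /T /tau; ring.
  by rewrite -(@derive_val _ _ _ _ _ _ _ h1) (@derive_val _ _ _ _ _ _ _ h2).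
transitivity (\sum_i partial_connection J (c1 t) (c2 t) (c3 t) (c4 t)
    (c5 t) (c6 t) d1 d2 d3 d4 d5 d6 x i i j k
   - \sum_i partial j (christoffel g i i k) x
   + (\sum_p (\sum_i G i i p) * G p j k - \sum_i \sum_p G i j p * G p i k)).
  rewrite /ricci /riemann -!sumrB -big_split /=.
  transitivity (\sum_i (partial_connection J (c1 t) (c2 t) (c3 t) (c4 t)
    (c5 t) (c6 t) d1 d2 d3 d4 d5 d6 x i i j k
    - partial j (christoffel g i i k) x + (\sum_p G i i p * G p j k - \sum_p G i j p * G p i k))).
    apply: eq_bigr => i _; rewrite dE; congr (_ + _).
    by rewrite -sumrB; apply: eq_bigr => p _; rewrite !GEx.
  rewrite !big_split /= !sumrN; congr (_ + (_ - _)).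
  by rewrite exchange_big; apply: eq_bigr => p _; rewrite mulr_suml.
rewrite trE (dconn_divergence skew orth) (conn_square skew orth).
have -> : \sum_p (\sum_i G i i p) * G p j k = tau * \sum_p x 0 p * G p j k.
  rewrite mulr_sumr; apply: eq_bigr => p _.
  by rewrite (conn_trace skew orth) mulrA.
rewrite (conn_radial skew) (eq_sym k j) -/t -/N /tau /dtau; ring.
Qed.

End RicciOfConnection.

(* The coefficients [P], [Q], [S] of a radial metric as functions of the squared
   radius, with their first and second derivatives. *)
Record profile (R : realType) := Profile {
  coefP : R -> R; coefP1 : R -> R; coefP2 : R -> R;
  coefQ : R -> R; coefQ1 : R -> R; coefQ2 : R -> R;
  coefS : R -> R; coefS1 : R -> R; coefS2 : R -> R }.

(** * Ricci coefficients as functions of the squared radius *)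

Section Profile.
Variables (R : realType) (N : R) (p : profile R).

Local Notation P := (coefP p).
Local Notation P1 := (coefP1 p).
Local Notation P2 := (coefP2 p).
Local Notation Q := (coefQ p).
Local Notation Q1 := (coefQ1 p).
Local Notation Q2 := (coefQ2 p).
Local Notation S := (coefS p).
Local Notation S1 := (coefS1 p).
Local Notation S2 := (coefS2 p).

Definition coefV t : R := P t + t * Q t.
Definition coefV1 t : R := P1 t + Q t + t * Q1 t.
Definition coefU t : R := P t + t * S t.
Definition coefU1 t : R := P1 t + S t + t * S1 t.
Definition coefU2 t : R := P2 t + 2 * S1 t + t * S2 t.

Local Notation V := coefV.
Local Notation V1 := coefV1.
Local Notation U := coefU.
Local Notation U1 := coefU1.
Local Notation U2 := coefU2.

(* [cc1], ..., [cc6] are the arguments of [radial_connection] for the metric [p],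
   [dc1], ..., [dc6] their derivatives, and [ctr] the factor of [x] in the trace. *)
Definition cc1 t : R := P1 t / P t.
Definition cc2 t : R := (Q t - P1 t) / V t.
Definition cc3 t : R := Q1 t / V t - 2 * P1 t * Q t / (P t * V t).
Definition cc4 t : R := S1 t / U t - (P1 t + S t) * S t / (P t * U t).
Definition cc5 t : R := - S1 t / V t + 2 * S t * Q t / (P t * V t).
Definition cc6 t : R := S t / P t.

Definition dc1 t : R := P2 t / P t - P1 t ^+ 2 / P t ^+ 2.
Definition dc2 t : R := (Q1 t - P2 t) / V t - (Q t - P1 t) * V1 t / V t ^+ 2.
Definition dc3 t : R := Q2 t / V t - Q1 t * V1 t / V t ^+ 2
  - 2 * (P2 t * Q t + P1 t * Q1 t) / (P t * V t)
  + 2 * P1 t * Q t * (P1 t / (P t ^+ 2 * V t) + V1 t / (P t * V t ^+ 2)).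
Definition dc4 t : R := S2 t / U t - S1 t * U1 t / U t ^+ 2
  - ((P2 t + S1 t) * S t + (P1 t + S t) * S1 t) / (P t * U t)
  + (P1 t + S t) * S t * (P1 t / (P t ^+ 2 * U t) + U1 t / (P t * U t ^+ 2)).
Definition dc5 t : R := - S2 t / V t + S1 t * V1 t / V t ^+ 2
  + 2 * (S1 t * Q t + S t * Q1 t) / (P t * V t)
  - 2 * S t * Q t * (P1 t / (P t ^+ 2 * V t) + V1 t / (P t * V t ^+ 2)).
Definition dc6 t : R := S1 t / P t - S t * P1 t / P t ^+ 2.

Definition ctr t : R := (N + 1) * cc1 t + cc2 t + t * cc3 t + t * cc4 t + cc6 t.
Definition dctr t : R :=
  (N + 1) * dc1 t + dc2 t + cc3 t + t * dc3 t + cc4 t + t * dc4 t + dc6 t.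

(* The coefficients of [1], [sq x] and [sq (J x)] in the Ricci tensor, in
   dimension [N]. *)
Definition ric0 t : R :=
  2 * cc1 t + 2 * t * dc2 t + N * cc2 t - 2 * cc6 t - ctr t + ctr t * t * cc2 t
  - 2 * cc1 t * cc2 t * t.
Definition ric1 t : R :=
  4 * dc1 t + 2 * t * dc3 t + (N + 2) * cc3 t - 2 * cc4 t - 2 * dctr t
  + ctr t * (2 * cc1 t + t * cc3 t)
  - (cc1 t * ctr t + cc1 t * (2 * cc1 t + t * cc3 t)
     + cc2 t * (cc1 t + cc2 t + t * cc3 t)
     + cc3 t * t * (2 * cc1 t + t * cc3 t + cc2 t)
     + (cc4 t * t + cc6 t) * (cc1 t + cc4 t * t + cc6 t)).
Definition ric2 t : R :=
  2 * cc4 t + 2 * t * dc5 t + (N + 2) * cc5 t - 4 * dc6 t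
  + ctr t * (t * cc5 t - 2 * cc6 t)
  - (cc1 t * (cc5 t * t - 2 * cc6 t) + cc2 t * (cc4 t * t + cc6 t)
     + cc4 t * t * (cc2 t + cc5 t * t - 2 * cc6 t)
     + (cc5 t * t - cc6 t) * (cc1 t + cc4 t * t + cc6 t)
     + cc6 t * (- cc1 t + cc2 t - cc4 t * t + cc5 t * t - cc6 t - N * cc6 t)).

Definition regular_profile (D : set R) := forall t, D t ->
  [/\ [/\ is_derive t 1 P (P1 t), is_derive t 1 Q (Q1 t) & is_derive t 1 S (S1 t)],
      [/\ is_derive t 1 P1 (P2 t), is_derive t 1 Q1 (Q2 t) & is_derive t 1 S1 (S2 t)]
    & [/\ P t != 0, V t != 0 & U t != 0]].

Variables (D : set R) (t : R).
Hypotheses (pD : regular_profile D) (Dt : D t).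

Lemma is_derive_coefV : is_derive t 1 V (V1 t).
Proof. have [[? ? ?] _ _] := pD Dt; by apply: is_derive_eq; rewrite /V1 /GRing.scale /=; ring. Qed.

Lemma is_derive_coefU : is_derive t 1 U (U1 t).
Proof. have [[? ? ?] _ _] := pD Dt; by apply: is_derive_eq; rewrite /U1 /GRing.scale /=; ring. Qed.

Lemma is_derive_christoffel_coefs :
  [/\ is_derive t 1 cc1 (dc1 t), is_derive t 1 cc2 (dc2 t),
      is_derive t 1 cc3 (dc3 t) &
  [/\ is_derive t 1 cc4 (dc4 t), is_derive t 1 cc5 (dc5 t) &
      is_derive t 1 cc6 (dc6 t)]].
Proof.
have [[dP dQ dS] [? ? ?] [P0 V0 U0]] := pD Dt.
have dV := is_derive_coefV; have dU := is_derive_coefU.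
have iP := is_derive_inv P0 dP.
have iV := is_derive_inv V0 dV.
have iU := is_derive_inv U0 dU.
have iPV := is_derive_inv (f := fun s => P s * V s) (mulf_neq0 P0 V0) (is_derive_mul dP dV).
have iPU := is_derive_inv (f := fun s => P s * U s) (mulf_neq0 P0 U0) (is_derive_mul dP dU).
split; last split; apply: is_derive_eq;
  rewrite /dc1 /dc2 /dc3 /dc4 /dc5 /dc6 /GRing.scale /=;
  by field; rewrite ?P0 ?V0 ?U0.
Qed.

End Profile.

Section RicciOfMetric.
Variables (R : realType) (n : nat) (J : 'M[R]_n).
Hypotheses (skew : J^T = - J) (orth : J *m J^T = 1%:M).

Lemma ricci_radial_metric (O : set 'rV[R]_n) g (p : profile R) D x j k
    (t := sqradius x) :
  open O -> O x -> regular_profile p D -> (forall y, O y -> D (sqradius y)) ->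
  (forall y, O y -> g y = radial_metric J (coefP p) (coefQ p) (coefS p) y) ->
  ricci g j k x = ric0 n%:R p t * (j == k)%:R
    + ric1 n%:R p t * (x 0 j * x 0 k) + ric2 n%:R p t * (rotation J x 0 j * rotation J x 0 k).
Proof.
move=> oO Ox pD OD gE.
have [D1 D2 D3 [D4 D5 D6]] := is_derive_christoffel_coefs pD (OD x Ox).
apply: (ricci_conn skew orth j k oO Ox _ D1 D2 D3 D4 D5 D6) => y l a b Oy.
have [[dP dQ dS] _ [P0 V0 U0]] := pD _ (OD y Oy).
exact: (christoffel_radial skew orth l a b oO Oy gE dP dQ dS P0 V0 U0).
Qed.

End RicciOfMetric.

Lemma derivative0_constant (R : realType) (D : set R) (f : R -> R) :
  is_interval D -> (forall t, D t -> is_derive t 1 f 0) ->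
  forall x y, D x -> D y -> f x = f y.
Proof.
move=> iD df.
suff le x y : D x -> D y -> x <= y -> f x = f y.
  by move=> x y Dx Dy; case: (leP x y) => [/le|/ltW/le xy]; [exact | exact/esym/xy].
move=> Dx Dy xy.
have Dz z : z \in `[x, y] -> D z by rewrite in_itv /= => ?; exact: (iD x y).
have dz z : z \in `]x, y[ -> is_derive z 1 f 0.
  by move=> zxy; apply: df; apply: Dz; exact: subset_itv_oo_cc.
have cf : {within `[x, y], continuous f}.
  apply: derivable_within_continuous => z zxy.
  exact: (@ex_derive _ _ _ _ _ _ _ (df z (Dz z zxy))).
by have [z _ /eqP] := MVT_segment xy dz cf; rewrite mul0r subr_eq0 => /eqP.
Qed.

(** * The Einstein equations as ordinary differential equations *)

Section Einstein.
Variables (R : realType) (M lam : R) (p : profile R).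
Local Notation P := (coefP p).
Local Notation P1 := (coefP1 p).
Local Notation P2 := (coefP2 p).
Local Notation Q := (coefQ p).
Local Notation Q1 := (coefQ1 p).
Local Notation Q2 := (coefQ2 p).
Local Notation S := (coefS p).
Local Notation S1 := (coefS1 p).
Local Notation S2 := (coefS2 p).
Local Notation V := (coefV p).
Local Notation U := (coefU p).

(* [warp], [fibre] and [slope] are [s], [H] and [G] of the header. *)
Definition warp t : R := t * P t.
Definition warp1 t : R := P t + t * P1 t.
Definition warp2 t : R := 2 * P1 t + t * P2 t.
Definition fibre t : R := t * U t.
Definition fibre1 t : R := U t + t * coefU1 p t.
Definition fibre2 t : R := 2 * coefU1 p t + t * coefU2 p t.
Definition slope t : R := warp1 t ^+ 2 / (V t * U t).
Definition slope1 t : R := 2 * warp1 t * warp2 t / (V t * U t)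
  - warp1 t ^+ 2 * (coefV1 p t * U t + V t * coefU1 p t) / (V t * U t) ^+ 2.

(** This is [warp] times the derivative of (slope - 1)/warp, so its vanishing makes that quotient
    constant. *)
Definition ode_slope t : R := slope1 t - (slope t - 1) * warp1 t / warp t.
Definition ode_fibre t : R :=
  2 * warp t * fibre1 t * slope t / warp1 t + fibre t
  + (2 * M - 3) * fibre t * slope t - 2 * M * warp t + lam * warp t ^+ 2.
Definition ode_fibre1 t : R :=
  2 * fibre1 t * slope t + 2 * warp t * fibre2 t * slope t / warp1 t
  + 2 * warp t * fibre1 t * slope1 t / warp1 t
  - 2 * warp t * fibre1 t * slope t * warp2 t / warp1 t ^+ 2 + fibre1 t
  + (2 * M - 3) * (fibre1 t * slope t + fibre t * slope1 t)
  - 2 * M * warp1 t + 2 * lam * warp t * warp1 t.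

Local Notation L0 := (ric0 (2 * M) p).
Local Notation L1 := (ric1 (2 * M) p).
Local Notation L2 := (ric2 (2 * M) p).

Section Algebra.
Variable t : R.
Hypotheses (t0 : t != 0) (P0 : P t != 0) (V0 : V t != 0) (U0 : U t != 0)
  (s0 : warp1 t != 0).

Local Ltac expand := rewrite /ric0 /ric1 /ric2 /ctr /dctr /ode_slope /ode_fibre
  /ode_fibre1 /slope1 /slope /fibre /fibre1 /fibre2 /cc1 /cc2 /cc3 /cc4 /cc5 /cc6
  /dc1 /dc2 /dc3 /dc4 /dc5 /dc6 /warp; move: V0 U0 s0;
  rewrite /warp1 /warp2 /coefV1 /coefU1 /coefU2 /coefV /coefU.

(** The Ricci curvatures of unit vectors along [x] and [rot x] are (L0 + t L1)/V and (L0 + t L2)/U;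
    a unit vector orthogonal to both has L0/P. The factor 2M - 2 counts the latter directions. *)
Lemma ricci_dr_sub_sigma :
  (L0 t + t * L1 t) / V t - (L0 t + t * L2 t) / U t =
  - (2 * M - 2) * (fibre t / (warp t * warp1 t)) * ode_slope t.
Proof. by expand => V0' U0' s0'; field; rewrite ?t0 ?P0 ?V0' ?U0' ?s0'. Qed.

Lemma ricci_horizontal : L0 t / P t - lam =
  - ode_fibre t / warp t ^+ 2 - fibre t / (warp t * warp1 t) * ode_slope t.
Proof. by expand => V0' U0' s0'; field; rewrite ?t0 ?P0 ?V0' ?U0' ?s0'. Qed.

(* By the contracted Bianchi identity the derivative of the horizontal equation
   gives the radial one; [ode_slope t = 0] is used to eliminate [Q1 t]. *)
Lemma ricci_dr : ode_slope t = 0 ->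
  (L0 t + t * L1 t) / V t - lam =
  ode_fibre t / warp t ^+ 2 - ode_fibre1 t / (warp t * warp1 t).
Proof.
have w0 : warp t != 0 by rewrite mulf_neq0.
move=> h.
have eQ : Q1 t = ((2 * warp1 t * warp2 t / (V t * U t)
    - warp1 t ^+ 2 * coefU1 p t / (V t * U t ^+ 2) - (slope t - 1) * warp1 t / warp t)
    * (V t ^+ 2 * U t / warp1 t ^+ 2) - P1 t - Q t) / t.
  (* [Q1 t] occurs in [ode_slope t] linearly, with coefficient - t warp1^2/(V^2 U). Adding the
     vanishing [ode_slope t], divided by minus this coefficient, cancels it. *)
  rewrite -[LHS]addr0 -[X in _ + X](mulr0 (V t ^+ 2 * U t / warp1 t ^+ 2 / t)) -h.
  rewrite /ode_slope /slope1 /slope /coefV1.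
  by field; rewrite ?t0 ?P0 ?V0 ?U0 ?s0 ?w0.
rewrite /ric0 /ric1 /ctr /dctr /ode_fibre /ode_fibre1 /slope1 /cc1 /cc2 /cc3 /cc4
  /cc5 /cc6 /dc1 /dc2 /dc3 /dc4 /dc5 /dc6 /coefV1 eQ.
move: {h eQ} V0 U0 s0.
rewrite /fibre /fibre1 /fibre2 /slope /warp /warp1 /warp2 /coefU1 /coefU2 /coefV /coefU.
by move=> V0' U0' s0'; field; rewrite ?t0 ?P0 ?V0' ?U0' ?s0'.
Qed.
End Algebra.

Variable D : set R.
Hypotheses (oD : open D) (pD : regular_profile p D)
  (Dpos : forall t, D t -> 0 < t /\ warp1 t != 0).

Lemma is_derive_warp t : D t -> is_derive t 1 warp (warp1 t).
Proof.
move=> Dt; have [[? ? ?] _ _] := pD Dt.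
by apply: is_derive_eq; rewrite /warp1 /GRing.scale /=; ring.
Qed.

Lemma is_derive_warp1 t : D t -> is_derive t 1 warp1 (warp2 t).
Proof.
move=> Dt; have [[? ? ?] [? ? ?] _] := pD Dt.
by apply: is_derive_eq; rewrite /warp2 /GRing.scale /=; ring.
Qed.

Lemma is_derive_fibre t : D t -> is_derive t 1 fibre (fibre1 t).
Proof.
move=> Dt; have ? := is_derive_coefU pD Dt.
by apply: is_derive_eq; rewrite /fibre1 /GRing.scale /=; ring.
Qed.

Lemma is_derive_fibre1 t : D t -> is_derive t 1 fibre1 (fibre2 t).
Proof.
move=> Dt; have ? := is_derive_coefU pD Dt; have [[? ? ?] [? ? ?] _] := pD Dt.
by apply: is_derive_eq; rewrite /fibre2 /coefU2 /coefU1 /GRing.scale /=; ring.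
Qed.

Lemma is_derive_slope t : D t -> is_derive t 1 slope (slope1 t).
Proof.
move=> Dt; have dU := is_derive_coefU pD Dt; have dV := is_derive_coefV pD Dt.
have [_ _ [P0 V0 U0]] := pD Dt; have ? := is_derive_warp1 Dt.
have ? := is_derive_inv (f := fun s => V s * U s) (mulf_neq0 V0 U0) (is_derive_mul dV dU).
apply: is_derive_eq; rewrite /slope1 /GRing.scale /=.
by field; rewrite ?V0 ?U0.
Qed.

Lemma is_derive_ode_fibre t : D t -> is_derive t 1 ode_fibre (ode_fibre1 t).
Proof.
move=> Dt; have ? := is_derive_warp Dt; have dw := is_derive_warp1 Dt.
have ? := is_derive_fibre Dt; have ? := is_derive_fibre1 Dt.
have ? := is_derive_slope Dt; have [_ w0] := Dpos Dt.
have ? := is_derive_inv w0 dw.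
apply: is_derive_eq; rewrite /ode_fibre1 /GRing.scale /=.
by field; rewrite ?w0.
Qed.

Hypothesis M1 : M != 1.

Lemma einstein_ode :
  (forall t, D t -> [/\ L0 t = lam * P t, L1 t = lam * Q t & L2 t = lam * S t]) <->
  (forall t, D t -> ode_slope t = 0 /\ ode_fibre t = 0).
Proof.
split=> h t Dt; have [_ _ [P0 V0 U0]] := pD Dt; have [/lt0r_neq0 t0 w0] := Dpos Dt;
  have s0 : warp t != 0 by rewrite mulf_neq0.
- have [e0 e1 e2] := h t Dt.
  have oS : ode_slope t = 0.
    have := ricci_dr_sub_sigma t0 P0 V0 U0 w0; rewrite e0 e1 e2.
    have -> : (lam * P t + t * (lam * Q t)) / V t - (lam * P t + t * (lam * S t)) / U t = 0.
      by move: V0 U0; rewrite /coefV /coefU => V0 U0; field; rewrite ?V0 ?U0.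
    move/esym/eqP; rewrite !mulf_eq0 !invr_eq0 mulf_eq0 oppr_eq0.
    rewrite (negbTE t0) (negbTE U0) (negbTE w0) (negbTE s0) /= orbF.
    (* In real dimension two there is no horizontal direction and the slope equation would be
       lost. *)
    have -> /= : (2 * M - 2 == 0) = false.
      by apply: contra_neqF M1 => /eqP ?; lra.
    by move/eqP.
  split=> //.
  have := ricci_horizontal t0 P0 V0 U0 w0; rewrite e0 oS mulr0 subr0 mulfK // subrr.
  move/esym/eqP; rewrite mulf_eq0 oppr_eq0 invr_eq0 expf_eq0 (negbTE s0) andbF orbF.
  by move/eqP.
have [oS oF] := h t Dt.
(* The horizontal equation holds on the whole open set [D], so it may be differentiated; this feeds
   [ricci_dr]. *)
have dF : ode_fibre1 t = 0.
  apply: (is_derive_vanishing oD Dt _ (is_derive_ode_fibre Dt)).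
  by move=> s Ds; have [] := h s Ds.
have e0 : L0 t = lam * P t.
  have := ricci_horizontal t0 P0 V0 U0 w0; rewrite oF oS oppr0 mul0r mulr0 subr0.
  by move/eqP; rewrite subr_eq0 => /eqP e; rewrite -e divfK.
have eV : L0 t + t * L1 t = lam * V t.
  have := ricci_dr t0 P0 V0 U0 w0 oS; rewrite oF dF !mul0r subr0.
  by move/eqP; rewrite subr_eq0 => /eqP e; rewrite -e divfK.
have eU : L0 t + t * L2 t = lam * U t.
  have := ricci_dr_sub_sigma t0 P0 V0 U0 w0; rewrite oS mulr0 eV mulfK //.
  by move/eqP; rewrite subr_eq0 => /eqP e; rewrite [in RHS]e divfK.
split=> //; apply: (mulfI t0).
  by move: eV; rewrite e0 /coefV; lra.
by move: eU; rewrite e0 /coefU; lra.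
Qed.
End Einstein.

(** * First integrals *)

Section Zpoly.
Variables (R : realType) (m : nat) (c E : R).
Implicit Type v : R.

(* [zpoly] is the sum in braces in the formula for [f], as a polynomial in
   [v = iota^2], with [c = mubar / a^2]. *)
Definition zcoef (k : nat) : R := (-1) ^+ (m - k) / (2 * k%:R - 1) * 'C(m, k)%:R *
  (2 * (m - k)%:R * E + (2 * m%:R - 1) * c).

Definition zpoly v : R := c * v ^+ m + \sum_(k < m) zcoef k * v ^+ k.

Definition zpoly1 v : R :=
  c * (m%:R * v ^+ m.-1) + \sum_(k < m) zcoef k * (k%:R * v ^+ k.-1).

Lemma is_derive_zpoly v : is_derive v 1 zpoly (zpoly1 v).
Proof.
have dXn k : is_derive v 1 (fun s : R => s ^+ k) (k%:R * v ^+ k.-1 * 1).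
  exact: is_derive_expn (is_derive_id _ _).
have dterm (k : 'I_m) : is_derive v 1 (fun s : R => zcoef k * s ^+ k) _ :=
  is_derive_mul (is_derive_const (zcoef k) v 1) (dXn k).
refine (is_derive_eq (is_derive_add
  (is_derive_mul (is_derive_const c v 1) (dXn m)) (is_derive_bigsum dterm)) _).
rewrite /zpoly1 /=; congr (_ + _); first by ring.
by apply: eq_bigr => k _; ring.
Qed.

Lemma odd_neq0 (k : nat) : 2 * k%:R - 1 != 0 :> R.
Proof. by rewrite subr_eq0 -natrM -[1]/(1%:R) eqr_nat; lia. Qed.

Hypothesis m0 : (0 < m)%N.

(** The operator 2v d/dv - 1 multiplies v^k by 2k - 1, cancelling the denominator of [zcoef k]. What
    remains is a combination of the binomial expansions of (v-1)^m and (v-1)^(m-1), with terms [A]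
    and [B]. *)
Lemma zpoly_ode v : 2 * v * zpoly1 v - zpoly v =
  (v - 1) ^+ m.-1 * ((2 * m%:R - 1) * c * (v - 1) - 2 * m%:R * E).
Proof.
have vX k : v * (k%:R * v ^+ k.-1) = k%:R * v ^+ k.
  by case: k => [|k]; rewrite ?mul0r ?mulr0 // [v ^+ k.+1]exprS /=; ring.
pose A k : R := (-1) ^+ (m - k) * v ^+ k *+ 'C(m, k).
pose B k : R := (-1) ^+ (m.-1 - k) * v ^+ k *+ 'C(m.-1, k).
have -> : 2 * v * zpoly1 v - zpoly v = (2 * m%:R - 1) * c * v ^+ m +
    \sum_(k < m) ((2 * m%:R - 1) * c * A k - 2 * m%:R * E * B k).
  rewrite /zpoly1 /zpoly mulrDr opprD addrACA mulr_sumr -sumrB; congr (_ + _).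
    have -> : 2 * v * (c * (m%:R * v ^+ m.-1)) = 2 * c * (v * (m%:R * v ^+ m.-1)) by ring.
    by rewrite vX; ring.
  apply: eq_bigr => k _.
  have -> : 2 * v * (zcoef k * (k%:R * v ^+ k.-1)) = 2 * zcoef k * (v * (k%:R * v ^+ k.-1)).
    by ring.
  rewrite vX.
  (* From m C(m-1,k) = (m-k) C(m,k); the sign changes because the exponent of -1 differs by one. *)
  have eB : m%:R * B k = - ((m - k)%:R * A k).
    rewrite /A /B -(mulr_natr _ 'C(m.-1, k)) -(mulr_natr _ 'C(m, k)).
    have -> : (m - k = (m.-1 - k).+1)%N by have := ltn_ord k; lia.
    have /(congr1 (fun z => z%:R : R)) : (m * 'C(m.-1, k) = (m.-1 - k).+1 * 'C(m, k))%N.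
      by rewrite mul_bin_down; congr (_ * _)%N; have := ltn_ord k; lia.
    rewrite !natrM exprS => e.
    transitivity ((-1) ^+ (m.-1 - k) * v ^+ k * (m%:R * 'C(m.-1, k)%:R)); first by ring.
    by rewrite e; ring.
  have -> : 2 * m%:R * E * B k = 2 * E * (m%:R * B k) by ring.
  rewrite eB /A /zcoef -(mulr_natr _ 'C(m, k)).
  by field; exact: odd_neq0.
rewrite sumrB -!mulr_sumr.
have -> : \sum_(k < m) B k = (v - 1) ^+ m.-1.
  by rewrite [v - 1]addrC exprDn prednK.
(* The missing top term v^m is supplied by the leading term of [zpoly]. *)
have -> : \sum_(k < m) A k = (v - 1) ^+ m - v ^+ m.
  rewrite [v - 1]addrC exprDn big_ord_recr /= /A subnn expr0 mul1r binn mulr1n.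
  by rewrite addrK.
have -> : (v - 1) ^+ m = (v - 1) * (v - 1) ^+ m.-1 by rewrite -exprS prednK.
by ring.
Qed.

End Zpoly.

(** * The function f freed of roots and negative powers *)

Section RadialF.
Variables (R : realType) (k : nat) (a mubar E F : R).
Local Notation m := k.+2.

Lemma radial_f_sqr e q : e = 1 \/ e = -1 -> 0 < q -> 0 < radicand m a mubar E F q ->
  radial_f m a mubar E F e q ^+ 2 =
  (if E == 0 then 1 else q ^+ k) / radicand m a mubar E F q.
Proof.
move=> he q0; have e2 : e ^+ 2 = 1 by case: he => ->; ring.
rewrite /radicand /radial_f; case: ifP => _ r0.
  by rewrite expr_div_n e2 sqr_sqrtr // ltW.
rewrite expr_div_n exprMn e2 mul1r sqr_sqrtr ?ltW //; congr (_ / _).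
rewrite -powR_mulrn ?powR_ge0 // -powRrM -[q ^+ k]powR_mulrn ?ltW //.
congr (_ `^ _); rewrite divfK ?pnatr_eq0 //.
by rewrite -[k.+2]addn2 natrD addrK.
Qed.

(** Since k = m - 2, the factor q^k clears the negative power F q^(2-m) and leaves F as an additive
    constant of integration. *)
Lemma radicand0E q : 0 < q -> q ^+ k * radicand0 m a mubar F q =
  F + q ^+ k.+2
  - (2 * m%:R - 1) / (2 * m%:R + 2) * (mubar / a ^+ 2) * q ^+ k.+3.
Proof.
move=> q0; rewrite /radicand0.
have -> : (2 - (m%:Z) = - (k%:Z))%R by lia.
rewrite -invr_expz -exprnP.
have qk : q ^+ k != 0 by rewrite expf_neq0 // gt_eqF.
rewrite mulrBr mulrDr mulrCA divff // mulr1; congr (_ + _ - _).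
  by rewrite -exprD addn2.
by rewrite !exprS; ring.
Qed.

(** With iota^2 = v all even powers of iota become powers of v; only iota^3 = v sqrt v keeps a
    root. *)
Lemma radicandE_zpoly q (v := 1 + E * q) : 0 < v ->
  radicandE m a mubar E F q =
  v * (F * Num.sqrt v - E ^- m.+1 * zpoly m (mubar / a ^+ 2) E v).
Proof.
move=> v0; rewrite /radicandE /= -/v.
have i2 : Num.sqrt v ^+ 2 = v by rewrite sqr_sqrtr // ltW.
rewrite mulrBr; congr (_ - _).
  by rewrite exprS i2; ring.
rewrite i2 -[RHS]mulrCA mulrA; congr (_ * _).
rewrite /zpoly exprM i2; congr (_ + _).
by rewrite big_mkord; apply: eq_bigr => i _; rewrite /zcoef exprM i2.
Qed.

End RadialF.

(** * Integration of the Einstein equations *)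

Section FirstIntegrals.
Variables (R : realType) (k : nat) (a mubar : R) (p : profile R) (D : set R).
Local Notation m := k.+2.
Local Notation M := (m%:R : R).
Hypotheses (a0 : a != 0) (oD : open D) (iD : is_interval D)
  (pD : regular_profile p D).
Hypothesis (Dpos : forall t, D t ->
  [/\ 0 < t, 0 < coefP p t, 0 < coefV p t, 0 < coefU p t & warp1 p t != 0]).

Local Notation lam := ((2 * M - 1) * mubar).
Local Notation c := (mubar / a ^+ 2).
Let q t : R := a ^+ 2 * warp p t.
Let q1 t : R := a ^+ 2 * warp1 p t.
Let K t : R := a ^+ 2 * fibre p t.
Let K1 t : R := a ^+ 2 * fibre1 p t.
Let a2 : 0 < a ^+ 2.
Proof. by rewrite exprn_even_gt0. Qed.
Let dq t : D t -> is_derive t 1 q (q1 t).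
Proof.
move=> Dt; have ? := is_derive_warp pD Dt.
by apply: is_derive_eq; rewrite /q1 /GRing.scale /=; ring.
Qed.
Let dK t : D t -> is_derive t 1 K (K1 t).
Proof.
move=> Dt; have ? := is_derive_fibre pD Dt.
by apply: is_derive_eq; rewrite /K1 /GRing.scale /=; ring.
Qed.
Let q_gt0 t : D t -> 0 < q t.
Proof. by case/Dpos => ? ? ? ? _; rewrite /q pmulr_rgt0 // mulr_gt0. Qed.
Let slope_gt0 t : D t -> 0 < slope p t.
Proof.
case/Dpos => ? ? ? ? w0; apply: divr_gt0; last exact: mulr_gt0.
by rewrite exprn_even_gt0.
Qed.

Let slope_integral t : R := (slope p t - 1) / q t.

Let d_slope_integral t : D t -> is_derive t 1 slope_integral (ode_slope p t / q t).
Proof.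
move=> Dt; have ? := dq Dt; have q0 := lt0r_neq0 (q_gt0 Dt).
have ? := is_derive_inv q0 (dq Dt).
have ? : is_derive t 1 (slope p) (slope1 p t).
  have [_ _ _ _ ?] := Dpos Dt.
  apply: (is_derive_slope pD) => //.
apply: is_derive_eq; rewrite /ode_slope /GRing.scale /=.
move: q0; rewrite /q /q1 mulf_eq0 negb_or => /andP[a20 w0].
by field; rewrite ?w0 ?a0 ?a20.
Qed.

(** The exponent m - 1 is chosen so that, with slope 1 + E q, the fibre equation becomes 2 (1 + E q)
    dY/dq - E Y = q^(m-1) (2m - (2m-1) c q). For E = 0 this is a plain quadrature, solved by
    [flat_integral]. *)
Let Y t : R := K t * q t ^+ k.+1.
Let Y1 t : R := K1 t * q t ^+ k.+1 + k.+1%:R * K t * q t ^+ k * q1 t.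
Let dY t : D t -> is_derive t 1 Y (Y1 t).
Proof.
move=> Dt; have dQ := dq Dt; have ? := dK Dt; have ? := is_derive_expn k.+1 dQ.
by apply: is_derive_eq; rewrite /Y1 /GRing.scale /=; ring.
Qed.

Let flat_integral t : R := Y t - q t ^+ k.+2
  + (2 * M - 1) / (2 * M + 2) * c * q t ^+ k.+3.

Let d_flat_integral t : D t -> slope p t = 1 ->
  is_derive t 1 flat_integral
    (a ^+ 2 * ode_fibre M lam p t * q t ^+ k * q1 t / 2).
Proof.
move=> Dt sl; have dQ := dq Dt; have ? := dY Dt.
have ? := is_derive_expn k.+2 dQ; have ? := is_derive_expn k.+3 dQ.
have [t0 P0 _ _ w1] := Dpos Dt.
apply: is_derive_eq; rewrite /Y1 /GRing.scale /= /ode_fibre sl.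
have kE : k.+1%:R = M - 1 by rewrite -[k.+2]addn1 natrD addrK.
have k3 : k.+3%:R = M + 1 by rewrite -[k.+3]addn1 natrD.
have M0 : 2 * M + 2 != 0 by rewrite gt_eqF // ltr_wpDl // mulr_ge0.
rewrite kE k3 !exprS; move: M M0 => N N0.
rewrite /K /K1 /q1; have -> : q t = a ^+ 2 * warp p t by [].
move: (_ ^+ k) => X.
by field; rewrite ?a0 ?w1 ?N0.
Qed.

(** Subtracting the particular solution - E^(-m-1) [zpoly] and dividing by the homogeneous solution
    sqrt v leaves a constant, namely F. *)
Let curved_integral E t : R := let v := 1 + E * q t in
  (Y t + E ^- m.+1 * zpoly m c E v) / Num.sqrt v.

Let d_curved_integral E t : D t -> E != 0 -> slope p t = 1 + E * q t ->
  is_derive t 1 (curved_integral E)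
    (a ^+ 2 * ode_fibre M lam p t * q t ^+ k * q1 t
      / (2 * slope p t * Num.sqrt (slope p t))).
Proof.
move=> Dt E0 sl; have dQ := dq Dt; have ? := dY Dt.
have [t0 P0 _ _ w1] := Dpos Dt.
pose v s := 1 + E * q s.
have dv : is_derive t 1 v (E * q1 t).
  by apply: is_derive_eq; rewrite /GRing.scale /=; ring.
have v0 : 0 < v t by rewrite /v -sl slope_gt0.
have dZ := is_derive_comp dv (is_derive_zpoly m c E (v t)).
have dsq := is_derive_comp dv (is_derive1_sqrt v0).
have s0 : Num.sqrt (v t) != 0 by rewrite gt_eqF // sqrtr_gt0.
have ? := is_derive_inv (f := fun s => Num.sqrt (v s)) s0 dsq.
apply: is_derive_eq.
rewrite /GRing.scale /= sl -/(v t).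
have := zpoly_ode c E (isT : (0 < m)%N) (v t).
have -> : v t - 1 = E * q t by rewrite /v addrAC subrr add0r.
rewrite exprMn /= => zode.
have {zode}z1 : zpoly1 m c E (v t) = (zpoly m c E (v t) + E ^+ k.+1 * q t ^+ k.+1 *
    ((2 * M - 1) * c * (E * q t) - 2 * M * E)) / (2 * v t).
  rewrite -zode; field; exact: lt0r_neq0.
rewrite z1.
have kE : k.+1%:R = M - 1 by rewrite -[k.+2]addn1 natrD addrK.
have sv : Num.sqrt (v t) ^+ 2 = v t by rewrite sqr_sqrtr // ltW.
rewrite /Y /Y1 kE /ode_fibre sl -/(v t).
have vE : v t = 1 + E * (a ^+ 2 * warp p t) by [].
move: (v t) (Num.sqrt (v t)) vE sv v0 s0 (zpoly _ _ _ _) => w r wE rw v0 s0 z.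
move: M => N.
rewrite !exprS; have -> : q t = a ^+ 2 * warp p t by [].
rewrite /K /K1 /q1; move: (E ^+ k) (expf_neq0 k E0) (_ ^+ k) => Ek Ek0 X.
(* Everything is expressed through r = sqrt v: [warp] becomes (r^2 - 1)/(E a^2) and the goal an
   identity of rational functions. *)
rewrite -rw in wE v0 *.
have {wE}-> : warp p t = (r ^+ 2 - 1) / (E * a ^+ 2).
  by rewrite wE; field; rewrite ?E0 ?a0.
by field; rewrite ?a0 ?E0 ?Ek0 ?s0 ?w1.
Qed.

(** Each equation is, up to a nonvanishing factor, the derivative of one of the integrals above. On
    the interval [D] a zero derivative gives the constants E and F; conversely, constant integrals
    have zero derivative on the open set [D]. *)
Lemma first_integrals : D !=set0 ->
  (forall t, D t -> ode_slope p t = 0 /\ ode_fibre M lam p t = 0) <->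
  exists E F, forall t, D t -> slope p t = 1 + E * q t /\
    radicand m a mubar E F (q t) =
    (if E == 0 then q t else q t ^+ k.+1 * (1 + E * q t)) * K t.
Proof.
move=> [t0 Dt0]; split=> [h|].
  have cst (f : R -> R) : (forall t, D t -> is_derive t 1 f 0) -> exists C, forall t, D t -> f t = C.
    move=> df; exists (f t0) => t Dt; exact: (derivative0_constant iD df).
  have [E hE] : exists E, forall t, D t -> slope_integral t = E.
    apply: cst => t Dt; have [oS _] := h t Dt.
    by apply: is_derive_eq; [exact: d_slope_integral | rewrite oS mul0r].
  have sl t : D t -> slope p t = 1 + E * q t.
    move=> Dt; rewrite -(hE t Dt) /slope_integral divfK ?lt0r_neq0 ?q_gt0 //; ring.
  exists E; have [E0|E0] := eqVneq E 0.
    have [F hF] : exists F, forall t, D t -> flat_integral t = F.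
      apply: cst => t Dt; have [_ oF] := h t Dt.
      apply: is_derive_eq; first by apply: d_flat_integral; rewrite // sl // E0 mul0r addr0.
      by rewrite oF; ring.
    exists F => t Dt; split; first by rewrite sl // E0.
    rewrite /radicand E0 eqxx; have qk : q t ^+ k != 0 by rewrite expf_neq0 // lt0r_neq0 ?q_gt0.
    apply: (mulfI qk); rewrite radicand0E ?q_gt0 // -(hF t Dt) /flat_integral /Y !exprS.
    by ring.
  have [F hF] : exists F, forall t, D t -> curved_integral E t = F.
    apply: cst => t Dt; have [_ oF] := h t Dt.
    apply: is_derive_eq; first by apply: d_curved_integral; rewrite // sl.
    by rewrite oF; ring.
  exists F => t Dt; split; first by rewrite sl.
  have v0 : 0 < 1 + E * q t by rewrite -sl // slope_gt0.
  rewrite /radicand (negbTE E0) /= radicandE_zpoly // -(hF t Dt) /curved_integral.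
  rewrite divfK ?gt_eqF ?sqrtr_gt0 // /Y; ring.
move=> [E [F h]] t Dt; have [sl _] := h t Dt.
have qs s : D s -> q s != 0 by move=> Ds; rewrite lt0r_neq0 ?q_gt0.
have a20 : a ^+ 2 != 0 by rewrite lt0r_neq0.
have [tt _ _ _ w1] := Dpos Dt.
have q10 : q1 t != 0 by rewrite mulf_neq0.
have zero (f : R -> R) df : (forall s, D s -> f s = 0) -> is_derive t 1 f df -> df = 0.
  by move=> f0; exact: (is_derive_vanishing oD Dt f0).
split.
  have /eqP : ode_slope p t / q t - 0 = 0.
    apply: (zero (fun s => slope_integral s - E)); last first.
      exact: is_derive_sub (d_slope_integral Dt) (is_derive_const _ _ _).
    move=> s Ds; have [sls _] := h s Ds; rewrite /slope_integral sls.
    by have := qs s Ds; move: (q s) => x x0; field.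
  by rewrite subr0 mulf_eq0 invr_eq0 (negbTE (qs _ Dt)) orbF => /eqP.
have v0 s : D s -> 0 < 1 + E * q s by move=> Ds; have [<- _] := h s Ds; exact: slope_gt0.
have [E0|E0] := eqVneq E 0.
  have /eqP : a ^+ 2 * ode_fibre M lam p t * q t ^+ k * q1 t / 2 - 0 = 0.
    apply: (zero (fun s => flat_integral s - F)); last first.
      apply: is_derive_sub (is_derive_const _ _ _).
      by apply: d_flat_integral; rewrite // sl E0 mul0r addr0.
    move=> s Ds; have [_] := h s Ds; rewrite /radicand E0 eqxx => e.
    have := radicand0E k a mubar F (q_gt0 Ds); rewrite e /flat_integral => r.
    have -> : Y s = q s ^+ k * (q s * K s) by rewrite /Y exprS; ring.
    by rewrite r; ring.
  have nz : a ^+ 2 * q t ^+ k * q1 t / 2 != 0.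
    by rewrite mulf_neq0 ?invr_eq0 ?pnatr_eq0 // mulf_neq0 // mulf_neq0 // expf_neq0 ?qs.
  by move=> /eqP e; apply: (mulfI nz); rewrite mulr0 -[RHS]e; ring.
have /eqP : a ^+ 2 * ode_fibre M lam p t * q t ^+ k * q1 t
      / (2 * slope p t * Num.sqrt (slope p t)) - 0 = 0.
  apply: (zero (fun s => curved_integral E s - F)); last first.
    by apply: is_derive_sub (is_derive_const _ _ _); apply: d_curved_integral.
  move=> s Ds; have [_] := h s Ds; rewrite /radicand (negbTE E0) radicandE_zpoly ?v0 //.
  rewrite [q s ^+ _ * _]mulrC -mulrA => /(mulfI (lt0r_neq0 (v0 s Ds))) e.
  rewrite /curved_integral /Y [K s * _]mulrC -e subrK mulfK ?subrr //.
  by rewrite gt_eqF // sqrtr_gt0 v0.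
have nz : a ^+ 2 * q t ^+ k * q1 t / (2 * slope p t * Num.sqrt (slope p t)) != 0.
  have sg := slope_gt0 Dt.
  have s2 : 2 * slope p t * Num.sqrt (slope p t) != 0.
    apply: mulf_neq0; last by rewrite gt_eqF // sqrtr_gt0.
    by apply: mulf_neq0; rewrite ?pnatr_eq0 ?lt0r_neq0.
  by rewrite mulf_neq0 ?invr_eq0 // mulf_neq0 // mulf_neq0 // expf_neq0 ?qs.
by move=> /eqP e; apply: (mulfI nz); rewrite mulr0 -[RHS]e; ring.
Qed.


End FirstIntegrals.

(** * The coframe and the Killing form *)

Section Frame.
Variables (R : realType) (n : nat).
Implicit Types (u v w x : 'rV[R]_n).

Lemma evE u v : ev u v = \sum_i u 0 i * v 0 i.
Proof. by rewrite /ev dotE mxE mulr1n. Qed.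

Lemma evC u v : ev u v = ev v u.
Proof. by rewrite !evE dotC. Qed.

Lemma evDr u v w : ev u (v + w) = ev u v + ev u w.
Proof. by rewrite /ev linearD /= mulmxDr mxE. Qed.

Lemma evZr u v (c : R) : ev u (c *: v) = c * ev u v.
Proof. by rewrite /ev linearZ /= -scalemxAr mxE. Qed.

Lemma evZl u v (c : R) : ev (c *: u) v = c * ev u v.
Proof. by rewrite evC evZr evC. Qed.

Lemma evDl u v w : ev (u + v) w = ev u w + ev v w.
Proof. by rewrite evC evDr !(evC w). Qed.

Lemma quad_sq u v : (v *m sq u *m v^T) 0 0 = ev u v ^+ 2.
Proof.
have -> : v *m sq u *m v^T = (v *m u^T) *m (u *m v^T) by rewrite /sq !mulmxA.
by rewrite [LHS]mxE big_ord1 -/(ev v u) -/(ev u v) evC expr2.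
Qed.

Lemma quad_eq0 (A : 'M[R]_n) : A^T = A ->
  (forall v, (v *m A *m v^T) 0 0 = 0) -> A = 0.
Proof.
move=> symA q0; apply/matrixP => i j; rewrite mxE.
pose e i : 'rV[R]_n := delta_mx 0 i.
have bil i' j' : (e i' *m A *m (e j')^T) 0 0 = A i' j'.
  by rewrite /e trmx_delta -rowE -colE !mxE.
have := q0 (e i + e j); rewrite linearD /= !mulmxDl !mulmxDr.
rewrite mxE [X in X + _]mxE [X in _ + X]mxE !bil => h.
have := q0 (e i); have := q0 (e j); rewrite !bil => hj hi.
have sA : A j i = A i j by rewrite -{1}symA mxE.
by move: h; rewrite hi hj sA; lra.
Qed.

Lemma trmx_sq u : (sq u)^T = sq u.
Proof. by rewrite /sq trmx_mul trmxK. Qed.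

Lemma sqZ u (c : R) : sq (c *: u) = c ^+ 2 *: sq u.
Proof. by rewrite /sq -scalemxAr [(c *: u)^T]linearZ /= -scalemxAl scalerA expr2. Qed.

Lemma ev_sqradius x : ev x x = sqradius x.
Proof. by rewrite evE dot_xx. Qed.

Lemma sqradius_ge0 x : 0 <= sqradius x.
Proof. by apply: sumr_ge0 => i _; exact: sqr_ge0. Qed.

Lemma eradius_sqr x : eradius x ^+ 2 = sqradius x.
Proof. by rewrite sqr_sqrtr // sqradius_ge0. Qed.

Lemma sqradius_gt0 x : x != 0 -> 0 < sqradius x.
Proof.
move=> x0; rewrite lt_neqAle sqradius_ge0 andbT eq_sym.
apply: contra_neq x0 => /eqP; rewrite psumr_eq0; last by move=> i _; exact: sqr_ge0.
move=> /allP h; apply/rowP => i; rewrite mxE; apply/eqP.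
by have := h i (mem_index_enum _); rewrite sqrf_eq0.
Qed.

Lemma eradius_gt0 x : x != 0 -> 0 < eradius x.
Proof. by move=> x0; rewrite sqrtr_gt0; exact: sqradius_gt0. Qed.

Lemma ev_direction x : x != 0 -> ev (direction x) (direction x) = 1.
Proof.
move=> x0; rewrite evZl evZr ev_sqradius -eradius_sqr.
by field; rewrite gt_eqF // eradius_gt0.
Qed.

Variables (W : set 'rV[R]_n) (sg : nat -> 'rV[R]_n -> 'rV[R]_n).
Hypotheses (W0 : ~ W 0) (hsg : sphere_coframe W sg) (n1 : (1 < n)%N).

Lemma W_neq0 x : W x -> x != 0.
Proof. by move=> Wx; apply: contra_notN W0 => /eqP <-. Qed.

(** Both sides are symmetric, so it is enough to compare quadratic forms. The normal part of a
    vector is killed by the forms on the left and by the projection on the right; on the tangential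
    part [v'] this is the round metric. *)
Lemma sphere_frame x : W x ->
  \sum_(1 <= k < n) sq (sg k (direction x)) = 1%:M - sq (direction x).
Proof.
move=> Wx; have [_ tang round] := hsg.
set u := direction x; have Du : (@direction R n @` W) u by exists x.
have uu : ev u u = 1 by rewrite ev_direction // W_neq0.
apply/eqP; rewrite -subr_eq0; apply/eqP; apply: quad_eq0.
  rewrite !linearB /= trmx1 trmx_sq linear_sum /=.
  by rewrite (eq_bigr _ (fun k _ => trmx_sq (sg k u))).
move=> v; pose v' := v - ev u v *: u.
have v'E : ev u v' = 0 by rewrite /v' evDr -scaleNr evZr uu mulr1 subrr.
have vv : ev v' v' = ev v v - ev u v ^+ 2.
  rewrite {1}/v' evDl -scaleNr evZl v'E mulr0 addr0.
  by rewrite /v' evDr -scaleNr evZr (evC v u); ring.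
have qB (A B : 'M[R]_n) : (v *m (A - B) *m v^T) 0 0 = (v *m A *m v^T) 0 0 - (v *m B *m v^T) 0 0.
  by rewrite mulmxBr mulmxBl [LHS]mxE [X in _ + X = _]mxE.
rewrite !qB mulmx1 -/(ev v v) quad_sq -vv -(round u Du _ v'E).
rewrite mulmx_sumr mulmx_suml summxE; apply/eqP; rewrite subr_eq0; apply/eqP.
rewrite !big_nat; apply: eq_bigr => k kn; rewrite quad_sq.
by rewrite /v' evDr -scaleNr evZr (tang u Du k kn) mulr0 addr0.
Qed.

(** Take [direction x] as row 0 and the sphere forms as rows 1 to n-1 of a square matrix M.
    [sphere_frame] says M^T M = 1; then M M^T = 1, so the rows are orthonormal. *)
Lemma sphere_frame_unit x k : W x -> (1 <= k < n)%N ->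
  ev (sg k (direction x)) (sg k (direction x)) = 1.
Proof.
move=> Wx /andP[k1 kn]; set u := direction x.
pose M : 'M[R]_n := \matrix_i (if (i : nat) == 0%N then u else sg i u).
have MM : M^T *m M = 1%:M.
  have -> : M^T *m M = \sum_(i < n) sq (row i M).
    apply/matrixP => i j; rewrite summxE mxE; apply: eq_bigr => l _.
    by rewrite sqE !mxE.
  pose f (i : nat) := sq (if i == 0%N then u else sg i u).
  have -> : \sum_(i < n) sq (row i M) = \sum_(0 <= i < n) f i.
    by rewrite big_mkord; apply: eq_bigr => i _; rewrite rowK.
  rewrite big_ltn; last exact: ltnW.
  rewrite [f 0%N]/f eqxx.
  have -> : \sum_(1 <= i < n) f i = \sum_(1 <= k < n) sq (sg k u).
    rewrite !big_nat; apply: eq_bigr => i /andP[i1 _].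
    by rewrite /f; case: i i1.
  by rewrite sphere_frame // addrC subrK.
have /matrixP/(_ (Ordinal kn) (Ordinal kn)) := mulmx1C MM.
rewrite mxE [RHS]mxE eqxx mulr1n => <-; rewrite evE; apply: eq_bigr => i _.
by rewrite !mxE /=; case: k k1 {kn}.
Qed.

Lemma ev_sigma x k : W x -> (1 <= k < n)%N -> ev (sigma sg k x) x = 0.
Proof.
move=> Wx kn; have [_ tang _] := hsg.
have x0 := eradius_gt0 (W_neq0 Wx).
have xE : x = eradius x *: direction x.
  by rewrite scalerA divff ?scale1r // gt_eqF.
by rewrite [X in ev _ X]xE evZl evZr tang ?mulr0 //; exists x.
Qed.

Lemma ev_sigma_unit x k : W x -> (1 <= k < n)%N ->
  sqradius x * ev (sigma sg k x) (sigma sg k x) = 1.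
Proof.
move=> Wx kn; rewrite evZl evZr sphere_frame_unit // -eradius_sqr.
by field; rewrite gt_eqF // eradius_gt0 // W_neq0.
Qed.

Lemma sigma_frame x : W x ->
  sqradius x *: \sum_(1 <= k < n) sq (sigma sg k x) = 1%:M - (sqradius x)^-1 *: sq x.
Proof.
move=> Wx; have x0 := eradius_gt0 (W_neq0 Wx).
have := sphere_frame Wx; rewrite [in RHS]/direction sqZ exprVn eradius_sqr => <-.
rewrite scaler_sumr; apply: eq_bigr => k _.
rewrite /sigma sqZ scalerA -eradius_sqr exprVn divff ?scale1r //.
by rewrite expf_neq0 // gt_eqF.
Qed.

Lemma sigma_frame_tail x : W x ->
  sqradius x *: \sum_(2 <= k < n) sq (sigma sg k x) =
  1%:M - (sqradius x)^-1 *: sq x - sqradius x *: sq (sigma sg 1 x).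
Proof.
move=> Wx; rewrite -sigma_frame // (big_ltn n1) scalerDr [in RHS]addrC addrA.
by rewrite addNr add0r.
Qed.

Lemma sq_dr x : W x -> sq (dr x) = (sqradius x)^-1 *: sq x.
Proof. by move=> Wx; rewrite /dr /direction sqZ exprVn eradius_sqr. Qed.

End Frame.

(** * Flat Killing fields orthogonal to the position vector *)

Section FlatKilling.
Variables (R : realType) (n : nat).
Implicit Types (x y v : 'rV[R]_n) (i j k : 'I_n).

Lemma derive_partial (f : 'rV[R]_n -> R) x v : differentiable f x ->
  'D_v f x = \sum_j v 0 j * partial j f x.
Proof.
move=> df; rewrite deriveE // {1}(row_sum_delta v) linear_sum.
by apply: eq_bigr => j _; rewrite linearZ /= /partial deriveE.
Qed.

Lemma is_derive_line (f : 'rV[R]_n -> R) y v s df :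
  is_derive (s *: v + y) v f df ->
  is_derive s 1 (fun u : R => f (u *: v + y)) df.
Proof.
move=> /is_derive_along h.
have sh : is_derive s 1 (fun u : R => u - s) 1.
  by refine (is_derive_eq (is_derive_sub (is_derive_id s 1) (is_derive_const s s 1)) _); rewrite subr0.
have : is_derive (s - s) 1 (fun h : R => f (h *: v + (s *: v + y))) df by rewrite subrr.
move=> /(is_derive_comp sh); rewrite mulr1.
suff -> : (fun u : R => f ((u - s) *: v + (s *: v + y))) = (fun u : R => f (u *: v + y)).
  by [].
by apply/funext => u; rewrite addrA -scalerDl subrK.
Qed.

(** A Killing field has a constant inner product with the velocity of a geodesic, here a straight
    segment. *)
Lemma flat_killing_segment (O : set 'rV[R]_n) (b : 'rV[R]_n -> 'rV[R]_n) :
  (forall x y (s : R), O x -> O y -> 0 <= s <= 1 -> O (s *: (x - y) + y)) ->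
  (forall x i, O x -> differentiable (fun z => b z 0 i) x) ->
  (forall x i j, O x ->
     partial j (fun z => b z 0 i) x + partial i (fun z => b z 0 j) x = 0) ->
  forall x y, O x -> O y -> ev (b x) (x - y) = ev (b y) (x - y).
Proof.
move=> cO db kb x y Ox Oy; set v := x - y.
pose phi (s : R) := \sum_i b (s *: v + y) 0 i * v 0 i.
have dphi (s : R) : `[0, 1]%classic s -> is_derive s 1 phi 0.
  rewrite /= in_itv /= => s01; have Oz := cO x y s Ox Oy s01.
  set z := s *: v + y.
  have e : \sum_i (\sum_j v 0 j * partial j (fun z => b z 0 i) z) * v 0 i = 0.
    set L := LHS.
    (* Exchanging the summation indices changes the sign, by the Killing equation. *)
    have L2 : L = - L.
      rewrite {1}/L; under eq_bigr do rewrite mulr_suml.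
      rewrite exchange_big /L -sumrN; apply: eq_bigr => i _.
      rewrite mulr_suml -sumrN; apply: eq_bigr => j _.
      have := kb z i j Oz; move: (partial _ _ _) (partial _ _ _) => A B.
      move=> /eqP; rewrite addr_eq0 => /eqP ->; ring.
    by move: L2; lra.
  rewrite -e; apply: is_derive_bigsum => i.
  have h : is_derive z v (fun w => b w 0 i) (\sum_j v 0 j * partial j (fun z => b z 0 i) z).
    rewrite -derive_partial; last exact: db.
    by apply: derivableP; apply: diff_derivable; exact: db.
  refine (is_derive_eq (is_derive_mul (is_derive_line h) (is_derive_const _ _ _)) _).
  by rewrite mulr0 addr0.
have := derivative0_constant (@interval_is_interval _ `[0, 1]) dphi.
move=> /(_ 1 0); rewrite /= !in_itv /= !lexx ler01 => /(_ isT isT).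
by rewrite /phi scale1r scale0r add0r /v subrK -/v !evE.
Qed.

(* [b x . y = - x . b y] for [x], [y] in [O], so [b x . y] is linear in both. *)
Lemma flat_killing_linear (O : set 'rV[R]_n) (b : 'rV[R]_n -> 'rV[R]_n) x0
    (A := \matrix_(i, j) - partial i (fun z => b z 0 j) x0) :
  open O -> O x0 ->
  (forall x y (s : R), O x -> O y -> 0 <= s <= 1 -> O (s *: (x - y) + y)) ->
  (forall x i, O x -> differentiable (fun z => b z 0 i) x) ->
  (forall x i j, O x ->
     partial j (fun z => b z 0 i) x + partial i (fun z => b z 0 j) x = 0) ->
  (forall x, O x -> ev (b x) x = 0) ->
  A^T = - A /\ forall x, O x -> b x = rotation A x.
Proof.
move=> oO Ox0 cO db kb bx0; split.
  apply/matrixP => i j; rewrite !mxE.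
  by have := kb x0 i j Ox0; lra.
have skew x y : O x -> O y -> ev (b x) y = - ev x (b y).
  move=> Ox Oy; have := flat_killing_segment cO db kb Ox Oy.
  have E u : ev u (x - y) = ev u x - ev u y by rewrite evDr -scaleN1r evZr mulN1r.
  by rewrite !E !bx0 // (evC x (b y)); lra.
move=> x Ox; apply/rowP => k; rewrite rotE.
(* With x fixed, differentiate b x . y = - x . b y in y at [x0]: the left side yields the component
   k of [b x], the right side a linear function of x. *)
have h1 : is_derive x0 (delta_mx 0 k) (fun y => ev (b x) y) (b x 0 k).
  under eq_fun do rewrite evE.
  refine (is_derive_eq (is_derive_bigsum (fun i =>
    is_derive_mul (is_derive_const _ _ _) (is_derive_coord_delta x0 i k))) _).
  by rewrite /=; under eq_bigr do rewrite mul0r add0r; rewrite sum_delta_rr.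
have h2 : is_derive x0 (delta_mx 0 k) (fun y => - ev x (b y))
    (\sum_j A k j * x 0 j).
  under eq_fun do rewrite evE.
  have dbi i : is_derive x0 (delta_mx 0 k) (fun y => b y 0 i) (partial k (fun z => b z 0 i) x0).
    by apply: derivableP; apply: diff_derivable; exact: db.
  refine (is_derive_eq (is_derive_opp (is_derive_bigsum (fun i =>
    is_derive_mul (is_derive_const _ _ _) (dbi i)))) _).
  rewrite -sumrN; apply: eq_bigr => j _; rewrite /= mxE; ring.
rewrite -(@derive_val _ _ _ _ _ _ _ h1) -(@derive_val _ _ _ _ _ _ _ h2).
apply: derive_val; apply: is_derive_near oO Ox0 _ (derivableP _); first by move=> y; exact: skew.
exact: ex_derive.
Qed.


End FlatKilling.

(** * Quadratic forms on open sets and convexity of balls *)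

Section QuadraticOpen.
Variables (R : realType) (n : nat).
Implicit Types (x y v : 'rV[R]_n) (i j k : 'I_n).

(** The gradient of the quadratic form is 2 B x, which vanishes on [O]; differentiating once more
    gives the entries of [B]. *)
Lemma quad_open_eq0 (O : set 'rV[R]_n) (B : 'M[R]_n) x0 : open O -> O x0 ->
  B^T = B -> (forall x, O x -> ev (rotation B x) x = 0) -> B = 0.
Proof.
move=> oO Ox0 symB B0.
have rot0 x k : O x -> rotation B x 0 k = 0.
  move=> Ox.
  have h : is_derive x (delta_mx 0 k) (fun y => ev (rotation B y) y) (2 * rotation B x 0 k).
    under eq_fun do rewrite evE.
    refine (is_derive_eq (is_derive_bigsum (fun i =>
      is_derive_mul (is_derive_rot B x i k) (is_derive_coord_delta x i k))) _).
    rewrite big_split /= sum_delta_rr rotE.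
    have -> : \sum_i B i k * x 0 i = \sum_j B k j * x 0 j.
      by apply: eq_bigr => i _; rewrite -{1}symB mxE.
    ring.
  by have := is_derive_vanishing oO Ox B0 h; lra.
apply/matrixP => k j; rewrite mxE.
exact: (is_derive_vanishing oO Ox0 (fun y => rot0 y k) (is_derive_rot B x0 k j)).
Qed.

(** The norm condition is the vanishing on [O] of the quadratic form of A^T A - a^2. *)
Lemma rot_orthogonal (O : set 'rV[R]_n) (A : 'M[R]_n) (a : R) x0 :
  open O -> O x0 -> a != 0 ->
  (forall x, O x -> ev (rotation A x) (rotation A x) = a ^+ 2 * sqradius x) ->
  (a^-1 *: A) *m (a^-1 *: A)^T = 1%:M.
Proof.
move=> oO Ox0 a0 nA; apply: mulmx1C.
have e : A^T *m A - (a ^+ 2)%:M = 0.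
  apply: quad_open_eq0 oO Ox0 _ _.
    by rewrite linearB /= trmx_mul trmxK tr_scalar_mx.
  move=> x Ox; have := nA x Ox.
  rewrite {1}/ev /rotation trmx_mul trmxK linearB /= trmx_mul trmxK tr_scalar_mx.
  rewrite /ev mulmxBr mulmxBl mul_mx_scalar -scalemxAl !mulmxA => h.
  rewrite [LHS]mxE h [X in _ + X]mxE [X in - X]mxE -/(ev x x) ev_sqradius; ring.
rewrite [_^T]linearZ /= -scalemxAl -scalemxAr scalerA.
move/eqP: e; rewrite subr_eq0 => /eqP ->.
by rewrite scale_scalar_mx; congr (_%:M); field.
Qed.

Lemma ball_convex x0 (e : R) x y s : ball x0 e x -> ball x0 e y ->
  0 <= s <= 1 -> ball x0 e (s *: (x - y) + y).
Proof.
rewrite -ball_normE /ball_ /= => xe ye /andP[s0 s1].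
have -> : x0 - (s *: (x - y) + y) = s *: (x0 - x) + (1 - s) *: (x0 - y).
  by apply/rowP => i; rewrite !mxE; ring.
apply: (le_lt_trans (ler_normD _ _)); rewrite !normrZ (ger0_norm s0) ger0_norm ?subr_ge0 //.
(* For s = 0 the strict inequality has to come from [y]; otherwise it comes from [x]. *)
have [->|s0'] := eqVneq s 0; first by rewrite mul0r add0r subr0 mul1r.
have sp : 0 < s by rewrite lt_neqAle eq_sym s0'.
apply: (@lt_le_trans _ _ (s * e + (1 - s) * e)); last by rewrite -mulrDl subrKC mul1r.
apply: ltr_leD; first by rewrite ltr_pM2l.
by rewrite ler_wpM2l ?subr_ge0 // ltW.
Qed.

Lemma differentiable_sqradius x : differentiable (@sqradius R n) x.
Proof.
have -> : @sqradius R n = \sum_i (fun y : 'rV[R]_n => y 0 i ^+ 2).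
  by apply/funext => y; rewrite fct_sumE.
apply: differentiable_sum => i.
exact: differentiableM (differentiable_coord _ _ _) (differentiable_coord _ _ _).
Qed.

End QuadraticOpen.

(** * The complex structure defined by beta *)

Section KillingForm.
Variables (R : realType) (n : nat) (mu a : R) (W : set 'rV[R]_n)
  (sg : nat -> 'rV[R]_n -> 'rV[R]_n)
  (alpha2 : 'rV[R]_n -> 'M[R]_n) (beta : 'rV[R]_n -> 'rV[R]_n).
Hypotheses (n1 : (1 < n)%N) (a0 : a != 0) (oW : open W) (W0 : ~ W 0)
  (hsg : sphere_coframe W sg)
  (hmu : forall x, W x -> 0 < 1 - mu * sqradius x)
  (halpha : forall x, W x ->
     alpha2 x = 1%:M + (mu / (1 - mu * sqradius x)) *: sq x)
  (hbeta : forall x, W x -> beta x = (a * sqradius x) *: sigma sg 1 x)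
  (hkilling : killing W alpha2 beta).

Let sigma1 : (1 <= 1 < n)%N. Proof. by rewrite n1. Qed.

Lemma ev_beta x : W x -> ev (beta x) x = 0.
Proof. by move=> Wx; rewrite hbeta // evZl (ev_sigma W0 hsg Wx sigma1) mulr0. Qed.

Lemma ev_beta_beta x : W x -> ev (beta x) (beta x) = a ^+ 2 * sqradius x.
Proof.
move=> Wx; rewrite hbeta // evZl evZr.
transitivity (a ^+ 2 * sqradius x * (sqradius x * ev (sigma sg 1 x) (sigma sg 1 x))).
  by ring.
by rewrite (ev_sigma_unit W0 hsg n1 Wx sigma1) mulr1.
Qed.

Lemma beta_invmx x : W x -> beta x *m invmx (alpha2 x) = beta x.
Proof.
move=> Wx; have d0 := lt0r_neq0 (hmu Wx).
have bx : beta x *m x^T = 0.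
  by rewrite dotE -evE ev_beta // raddf0.
have ba : beta x *m alpha2 x = beta x.
  rewrite halpha // mulmxDr mulmx1 -scalemxAr /sq mulmxA bx mul0mx scaler0 addr0 //.
have uA : alpha2 x \in unitmx.
  (* The inverse of [alpha2 x] is explicit, because [sq x] squares to |x|^2 [sq x]. *)
  have [] // := @mulmx1_unit _ _ (alpha2 x) (1%:M - mu *: sq x).
  rewrite halpha // mulmxDl mul1mx mulmxBr mulmx1 -scalemxAl -scalemxAr sq_mul.
  rewrite dot_xx -/(sq x); move: (sq x) => X; apply/matrixP => i j; rewrite !mxE.
  by case: (i == j); rewrite ?mulr1n ?mulr0n; field.
by rewrite -{1}ba mulmxK.
Qed.

Lemma sqnorm_beta x : W x -> sqnorm alpha2 beta x = a ^+ 2 * sqradius x.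
Proof. by move=> Wx; rewrite /sqnorm beta_invmx // -ev_beta_beta. Qed.

(** The lowered symbols of [alpha] are multiples of x_l, while raising an index leaves [beta] fixed
    and [beta] is orthogonal to x. Hence covariant derivatives of [beta] are partial derivatives. *)
Lemma christoffel_beta x i j : W x ->
  \sum_k christoffel alpha2 k i j x * beta x 0 k = 0.
Proof.
move=> Wx; have d0 := lt0r_neq0 (hmu Wx).
pose Q t := mu / (1 - mu * t).
have gE y : W y -> alpha2 y = radial_metric (0 : 'M[R]_n) (fun=> 1) Q (fun=> 0) y.
  by move=> Wy; rewrite halpha // /radial_metric scale0r addr0.
have dQ : is_derive (sqradius x) 1 Q (mu ^+ 2 / (1 - mu * sqradius x) ^+ 2).
  have dd : is_derive (sqradius x) 1 (fun t : R => 1 - mu * t) (- mu).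
    refine (is_derive_eq (is_derive_sub (is_derive_const _ _ _)
      (is_derive_mul (is_derive_const mu _ _) (is_derive_id _ _))) _); ring.
  have di := is_derive_inv (f := fun t => 1 - mu * t) d0 dd.
  by refine (is_derive_eq (is_derive_mul (is_derive_const mu _ _) di) _); field.
have skew0 : (0 : 'M[R]_n)^T = - 0 by rewrite trmx0 oppr0.
have lc l := lowered_christoffel i j l skew0 oW Wx gE (is_derive_const 1 _ _) dQ (is_derive_const 0 _ _).
pose X l : R := partial i (fun z => alpha2 z j l) x + partial j (fun z => alpha2 z i l) x
     - partial l (fun z => alpha2 z i j) x.
transitivity (2^-1 * \sum_l (beta x *m invmx (alpha2 x)) 0 l * X l).
  rewrite mulr_sumr.
  transitivity (\sum_k \sum_l 2^-1 * (beta x 0 k * invmx (alpha2 x) k l * X l)).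
    apply: eq_bigr => k _; rewrite /christoffel mulr_sumr mulr_suml.
    by apply: eq_bigr => l _; rewrite -/(X l); ring.
  rewrite exchange_big; apply: eq_bigr => l _ /=.
  by rewrite -mulr_sumr [in RHS]mxE mulr_suml.
have rot0 y : rotation (0 : 'M[R]_n) y = 0 by rewrite /rotation trmx0 mulmx0.
rewrite beta_invmx //.
transitivity (2^-1 * \sum_l (2 * (Q (sqradius x) * (i == j)%:R
    + mu ^+ 2 / (1 - mu * sqradius x) ^+ 2 * x 0 i * x 0 j)) * (beta x 0 l * x 0 l)).
  congr (_ * _); apply: eq_bigr => l _.
  by rewrite /X lc rot0 !mxE; ring.
by rewrite -mulr_sumr -evE ev_beta // !mulr0.
Qed.

(** The formula for [beta] taken at every point, so that differentiability comes from that of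
    sigma_1; it agrees with [beta] on [W]. *)
Let b y : 'rV[R]_n := (a * sqradius y) *: sigma sg 1 y.

Let b_diff x i : W x -> differentiable (fun z => b z 0 i) x.
Proof.
move=> Wx; have [sm _ _] := hsg.
have -> : (fun z => b z 0 i) =
    ((fun z => a * sqradius z) * (fun z => sigma sg 1 z 0 i) : 'rV[R]_n -> R).
  by apply/funext => z; rewrite /b mxE.
apply: differentiableM; last exact: (sm 1%N i sigma1 [::] x Wx).
apply: differentiableM; first exact: differentiable_cst.
exact: differentiable_sqradius.
Qed.

(** A ball inside [W] provides the segments that linearity needs, and [J] is the resulting matrix
    divided by a. *)
Lemma killing_rotation x0 : W x0 -> exists O J,
  [/\ open O, O x0, O `<=` W, J^T = - J
    & J *m J^T = 1%:M /\ forall x, O x -> beta x = a *: rotation J x].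
Proof.
move=> Wx0; have := oW Wx0 => /nbhs_ballP[e e0 eW].
have bb x : W x -> b x = beta x by move=> Wx; rewrite hbeta.
have pb x i j : W x -> partial j (fun z => b z 0 i) x = covd alpha2 beta i j x.
  move=> Wx; rewrite /covd christoffel_beta // subr0 /partial.
  apply: near_eq_derive; near=> y; rewrite bb //.
  by near: y; exact: open_nbhs_nbhs.
have oO := @ball_open R _ x0 e.
have Ox0 : ball x0 e x0 by exact: ballxx.
have kb x i j : ball x0 e x ->
    partial j (fun z => b z 0 i) x + partial i (fun z => b z 0 j) x = 0.
  by move=> /eW Wx; rewrite !pb // hkilling.
have evb x : ball x0 e x -> ev (b x) x = 0 by move=> /eW Wx; rewrite bb // ev_beta.
have [skew rotA] := flat_killing_linear oO Ox0
  (fun x y s Ox Oy => ball_convex Ox Oy)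
  (fun x i Ox => b_diff i (eW x Ox)) kb
  evb.
set A := (X in X^T = - X) in skew rotA.
exists (ball x0 e), (a^-1 *: A); split=> //.
  by rewrite linearZ /= skew scalerN.
split.
  apply: rot_orthogonal oO Ox0 a0 _ => x Ox.
  by rewrite -rotA // bb ?ev_beta_beta //; exact: eW.
move=> x Ox; rewrite -bb ?rotA //; last exact: eW.
by rewrite /rotation [(a^-1 *: A)^T]linearZ /= -scalemxAr scalerA divff // scale1r.
Unshelve. all: by end_near. Qed.

End KillingForm.

(** * Smoothness of the radial functions *)

Section Smooth.
Variable R : realType.
Implicit Types (D : set R) (f g h : R -> R) (k : nat).

(* [Cn k] asks for [k + 1] derivatives. *)
Fixpoint Cn k D f : Prop :=
  (forall t, D t -> derivable f t 1) /\ (if k is j.+1 then Cn j D (derive1 f) else True).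

(** [Cn] peels off the innermost derivative, which suits proofs by induction on the order that apply
    the hypothesis to [derive1 f]. *)
Lemma smooth1_onP D f : smooth1_on D f <-> forall k, Cn k D f.
Proof.
split=> [sm k|c k t Dt].
  elim: k f sm => [|k IH] f sm /=; split=> //; try by move=> t Dt; exact: (sm 0%N).
  by apply: IH => j t Dt; rewrite -derive1Sn; exact: sm.
elim: k f {c}(c k) => [|k IH] f [df cf]; first exact: df.
by rewrite derive1Sn; exact: IH.
Qed.

Lemma CnW k D f : Cn k.+1 D f -> Cn k D f.
Proof. by elim: k f => [|k IH] f [df cf]; split=> //; exact: IH. Qed.

Lemma Cn_ext k D f g : open D -> (forall t, D t -> f t = g t) -> Cn k D f -> Cn k D g.
Proof.
move=> oD; have near_eq (u v : R -> R) t : (forall t, D t -> u t = v t) -> D t -> \near t, u t = v t.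
  by move=> uv Dt; near=> s; apply: uv; near: s; exact: open_nbhs_nbhs.
elim: k f g => [|k IH] f g fg [df cf]; split.
- by move=> t Dt; exact: near_eq_derivable (near_eq f g t fg Dt) (df t Dt).
- by [].
- by move=> t Dt; exact: near_eq_derivable (near_eq f g t fg Dt) (df t Dt).
apply: IH cf => t Dt; rewrite !derive1E.
exact: near_eq_derive (near_eq f g t fg Dt).
Unshelve. all: by end_near. Qed.

Lemma is_derive_Cn k D f t : Cn k D f -> D t -> is_derive t 1 f ((derive1 f) t).
Proof. by case: k => [|k] [df _] Dt; rewrite derive1E; apply: derivableP; exact: df. Qed.

Lemma Cn_intro k D f f' : open D -> (forall t, D t -> is_derive t 1 f (f' t)) ->
  (if k is j.+1 then Cn j D f' else True) -> Cn k D f.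
Proof.
move=> oD df cf; have d t : D t -> derivable f t 1.
  by move=> Dt; exact: (@ex_derive _ _ _ _ _ _ _ (df t Dt)).
case: k cf => [|k] cf; split; [exact: d|by []|exact: d|].
apply: Cn_ext oD _ cf => t Dt.
by rewrite derive1E (@derive_val _ _ _ _ _ _ _ (df t Dt)).
Qed.

Variable D : set R.
Hypothesis oD : open D.

Lemma Cn_cst k (c : R) : Cn k D (fun=> c).
Proof.
elim: k c => [|k IH] c;
  apply: (Cn_intro (f' := fun=> 0) oD (fun t _ => is_derive_const c t 1)); [exact: I | exact: IH].
Qed.

Lemma Cn_id k : Cn k D id.
Proof.
case: k => [|k]; apply: (Cn_intro (f' := fun=> 1) oD (fun t _ => is_derive_id t 1)).
  exact: I.
exact: Cn_cst.
Qed.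

Lemma CnD k f g : Cn k D f -> Cn k D g -> Cn k D (fun t => f t + g t).
Proof.
move=> cf cg.
have d t : D t -> is_derive t 1 (fun t => f t + g t) (derive1 f t + derive1 g t).
  by move=> Dt; exact: is_derive_add (is_derive_Cn cf Dt) (is_derive_Cn cg Dt).
elim: k f g cf cg d => [|k IH] f g cf cg d; apply: (Cn_intro oD d); first by [].
have [[_ cf'] [_ cg']] := (cf, cg).
by apply: IH => // t Dt; exact: is_derive_add (is_derive_Cn cf' Dt) (is_derive_Cn cg' Dt).
Qed.

Lemma CnM k f g : Cn k D f -> Cn k D g -> Cn k D (fun t => f t * g t).
Proof.
elim: k f g => [|k IH] f g cf cg;
  have d t : D t -> is_derive t 1 (fun t => f t * g t) (derive1 f t * g t + f t * derive1 g t)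
    by move=> Dt; exact: is_derive_mul (is_derive_Cn cf Dt) (is_derive_Cn cg Dt).
  by apply: (Cn_intro oD d).
apply: (Cn_intro oD d).
have [_ cf'] := cf; have [_ cg'] := cg.
exact: CnD (IH _ _ cf' (CnW cg)) (IH _ _ (CnW cf) cg').
Qed.

Lemma Cn_comp k D' f g : (forall t, D t -> D' (g t)) ->
  Cn k D' f -> Cn k D g -> Cn k D (fun t => f (g t)).
Proof.
move=> gD; elim: k f => [|k IH] f cf cg;
  have d t : D t -> is_derive t 1 (fun t => f (g t)) (derive1 f (g t) * derive1 g t)
    by move=> Dt; exact: is_derive_comp (is_derive_Cn cg Dt) (is_derive_Cn cf (gD t Dt)).
  by apply: (Cn_intro oD d).
apply: (Cn_intro oD d).
have [_ cf'] := cf; have [_ cg'] := cg.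
exact: CnM (IH _ cf' (CnW cg)) cg'.
Qed.

Lemma Cn_expR k g : Cn k D g -> Cn k D (fun t => expR (g t)).
Proof.
elim: k => [|k IH] cg;
  have d t : D t -> is_derive t 1 (fun t => expR (g t)) (expR (g t) * derive1 g t)
    by move=> Dt; exact: is_derive_comp (is_derive_Cn cg Dt) (is_derive_expR _).
  by apply: (Cn_intro oD d).
by apply: (Cn_intro oD d); have [_ cg'] := cg; exact: CnM (IH (CnW cg)) cg'.
Qed.

(** The derivative is written with products of 1/g only, so that the induction hypothesis applies to
    its factors. *)
Lemma CnV k g : (forall t, D t -> g t != 0) -> Cn k D g -> Cn k D (fun t => (g t)^-1).
Proof.
move=> g0; elim: k => [|k IH] cg;
  have d t : D t -> is_derive t 1 (fun t => (g t)^-1)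
      (- 1 * derive1 g t * ((g t)^-1 * (g t)^-1))
    by move=> Dt; refine (is_derive_eq (is_derive_inv (g0 t Dt) (is_derive_Cn cg Dt)) _);
       have := g0 t Dt; move: (g t) => z z0; field.
  by apply: (Cn_intro oD d).
have [_ cg'] := cg; have iV := IH (CnW cg).
by apply: (Cn_intro oD d); exact: CnM (CnM (Cn_cst _ _) cg') (CnM iV iV).
Qed.

End Smooth.

(** * The sets of radii and squared radii *)

Section RadialSets.
Variables (R : realType) (n : nat) (W : set 'rV[R]_n).
Hypotheses (oW : open W) (cW : connected W) (W0 : ~ W 0).

Lemma continuous_sqradius : continuous (@sqradius R n).
Proof. by move=> x; apply: differentiable_continuous; exact: differentiable_sqradius. Qed.

Lemma sqradiusZ (c : R) (x : 'rV[R]_n) : sqradius (c *: x) = c ^+ 2 * sqradius x.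
Proof. by rewrite -!ev_sqradius evZl evZr mulrA expr2. Qed.

Lemma eradiusZ (c : R) (x : 'rV[R]_n) : 0 <= c -> eradius (c *: x) = c * eradius x.
Proof.
move=> c0; rewrite /eradius -/(sqradius _) -/(sqradius _) sqradiusZ sqrtrM ?sqr_ge0 //.
by rewrite sqrtr_sqr ger0_norm.
Qed.

Lemma interval_sqradius : is_interval (@sqradius R n @` W).
Proof.
apply/connected_intervalP; apply: connected_continuous_connected => //.
by apply: continuous_subspaceT => x; exact: continuous_sqradius.
Qed.

Lemma ray_near (x : 'rV[R]_n) : W x -> exists2 e : R, 0 < e &
  forall c, `|1 - c| < e -> W (c *: x).
Proof.
move=> Wx; have : \forall c \near (1 : R), W (c *: x).
  have cv : (fun c : R => c *: x) @ (1 : R) --> 1 *: x.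
    exact: (@scalel_continuous _ _ x 1).
  by apply: cv; rewrite scale1r; exact: open_nbhs_nbhs.
move=> /nbhs_ballP[e /= e0 h]; exists e => // c ce; exact: h.
Qed.

(** Moving a point of [W] along its ray realizes all nearby radii. *)
Lemma open_eradius : open (@eradius R n @` W).
Proof.
rewrite openE => _ [x Wx <-]; have r0 := eradius_gt0 (W_neq0 W0 Wx).
have [e e0 h] := ray_near Wx.
(* The first bound keeps the scaled point in [W], the second keeps the radius positive. *)
apply/nbhs_ballP; exists (Num.min (e * eradius x) (eradius x)) => /=.
  by rewrite lt_min mulr_gt0.
move=> r; rewrite -ball_normE /ball_ /= lt_min => /andP[d1 d2].
have rp : 0 < r by move: d2; rewrite ltr_norml => /andP[_]; lra.
exists ((r / eradius x) *: x).
  apply: h; have -> : 1 - r / eradius x = (eradius x - r) / eradius x.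
    by field; rewrite gt_eqF.
  by rewrite normrM normfV (gtr0_norm r0) ltr_pdivrMr.
by rewrite eradiusZ ?divr_ge0 ?ltW // divfK // gt_eqF.
Qed.

Lemma open_sqradius : open (@sqradius R n @` W).
Proof.
have -> : @sqradius R n @` W = [set t | 0 < t] `&` Num.sqrt @^-1` (@eradius R n @` W).
  apply/seteqP; split=> t.
    move=> [x Wx <-]; split=> /=; first exact: (sqradius_gt0 (W_neq0 W0 Wx)).
    by exists x.
  move=> [/= t0 [x Wx e]]; exists x => //.
  by rewrite -eradius_sqr e sqr_sqrtr // ltW.
apply: openI; first exact: open_gt.
apply: open_comp; last exact: open_eradius.
by move=> t _; exact: sqrt_continuous.
Qed.

End RadialSets.

(** * The deformed metric *)

Section RadialTensors.
Variables (R : realType) (n : nat) (J : 'M[R]_n).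
Hypotheses (skew : J^T = - J) (orth : J *m J^T = 1%:M) (n2 : (2 < n)%N).

(** Evaluation on [x] and on [rotation J x] gives t A1 = t A2 = - A0; the trace then gives (n - 2)
    A0 = 0. *)
Lemma radial_tensor_eq0 (x : 'rV[R]_n) A0 A1 A2 : x != 0 ->
  A0%:M + A1 *: sq x + A2 *: sq (rotation J x) = 0 -> [/\ A0 = 0, A1 = 0 & A2 = 0].
Proof.
move=> x0 e; set t := sqradius x; have t0 : t != 0 by rewrite gt_eqF // sqradius_gt0.
have q v : A0 * ev v v + A1 * ev x v ^+ 2 + A2 * ev (rotation J x) v ^+ 2 = 0.
  have /matrixP/(_ 0 0) := congr1 (fun M : 'M[R]_n => v *m M *m v^T) e.
  rewrite !mulmxDr !mulmxDl mul_mx_scalar -!scalemxAr -!scalemxAl mulmx0 mul0mx.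
  rewrite [RHS]mxE => <-; rewrite [RHS]mxE [X in _ = X + _]mxE.
  by rewrite [X in _ = X + _ + _]mxE [X in _ = _ + X + _]mxE [X in _ = _ + X]mxE !quad_sq.
have qx := q x; have qw := q (rotation J x).
move: qx qw; rewrite !evE dot_xx (dot_ww skew orth) (dot_wx skew) (dot_xw skew) -/t => qx qw.
have tr : A0 * n%:R + A1 * t + A2 * t = 0.
  have := congr1 (fun M : 'M[R]_n => \tr M) e.
  rewrite !mxtraceD !mxtraceZ mxtrace_scalar mxtrace0 mulr_natr.
  by rewrite ![\tr (sq _)]mxtrace_mulC !dotE !mxtrace_scalar !mulr1n dot_xx (dot_ww skew orth).
have e1 : A1 * t = - A0 by apply: (mulIf t0); move: qx; lra.
have e2 : A2 * t = - A0 by apply: (mulIf t0); move: qw; lra.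
have A00 : A0 = 0.
  have n0 : (n%:R - 2 : R) != 0 by rewrite gt_eqF // subr_gt0 ltr_nat.
  by apply: (mulIf n0); move: tr; rewrite e1 e2; lra.
by split=> //; apply: (mulIf t0); rewrite ?e1 ?e2 A00 oppr0 mul0r.
Qed.

Lemma radial_tensor_inj (x : 'rV[R]_n) A0 A1 A2 B0 B1 B2 : x != 0 ->
  A0%:M + A1 *: sq x + A2 *: sq (rotation J x) = B0%:M + B1 *: sq x + B2 *: sq (rotation J x) ->
  [/\ A0 = B0, A1 = B1 & A2 = B2].
Proof.
move=> x0 e; have [] := @radial_tensor_eq0 x (A0 - B0) (A1 - B1) (A2 - B2) x0.
  move: (sq x) (sq (rotation J x)) e => X Y /matrixP e; apply/matrixP => i j.
  have := e i j; rewrite !mxE.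
  by case: (i == j); rewrite ?mulr1n ?mulr0n; lra.
by move=> /subr0_eq-> /subr0_eq-> /subr0_eq->.
Qed.

End RadialTensors.

(** * The deformed metric and its radial variable *)

Section Deformation.
Variables (R : realType) (k : nat).
Local Notation m := k.+2.
Local Notation n := (2 * m)%N.
Local Notation M := (m%:R : R).
Variables (mu mubar a : R) (W : set 'rV[R]_n) (sg : nat -> 'rV[R]_n -> 'rV[R]_n)
  (alpha2 : 'rV[R]_n -> 'M[R]_n) (beta : 'rV[R]_n -> 'rV[R]_n)
  (rho kappa : R -> R) (alphabar2 : 'rV[R]_n -> 'M[R]_n).
Hypotheses (a0 : a != 0) (hW : region W) (hsg : sphere_coframe W sg)
  (hmu : forall x, W x -> 0 < 1 - mu * eradius x ^+ 2)
  (halpha : forall x, W x ->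
     alpha2 x = (1 - mu * eradius x ^+ 2)^-1 *: sq (dr x)
       + eradius x ^+ 2 *: \sum_(1 <= k < n) sq (sigma sg k x))
  (hbeta : forall x, W x -> beta x = (a * eradius x ^+ 2) *: sigma sg 1 x)
  (hkilling : killing W alpha2 beta)
  (hrho : smooth1_on (sqnorm alpha2 beta @` W) rho)
  (hkappa : smooth1_on (sqnorm alpha2 beta @` W) kappa)
  (hDelta : forall x, W x ->
     0 < 1 - sqnorm alpha2 beta x * kappa (sqnorm alpha2 beta x))
  (halphabar : forall x, W x ->
     alphabar2 x = expR (rho (sqnorm alpha2 beta x)) ^+ 2 *:
       (alpha2 x - kappa (sqnorm alpha2 beta x) *: sq (beta x)))
  (hreg : forall x, W x ->
     derive1 (fun r : R => expR (rho (a ^+ 2 * r ^+ 2)) * r) (eradius x) != 0).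

Let oW : open W. Proof. by case: hW. Qed.
Let W0 : ~ W 0. Proof. by case: hW. Qed.
Let n1 : (1 < n)%N. Proof. by lia. Qed.
Let n2 : (2 < n)%N. Proof. by lia. Qed.
Let neq0 x : W x -> x != 0. Proof. exact: W_neq0. Qed.
Let t_gt0 x : W x -> 0 < sqradius x. Proof. by move=> /neq0; exact: sqradius_gt0. Qed.

Let hmu' x : W x -> 0 < 1 - mu * sqradius x.
Proof. by move=> /hmu; rewrite eradius_sqr. Qed.

Let alphaE x : W x -> alpha2 x = 1%:M + (mu / (1 - mu * sqradius x)) *: sq x.
Proof.
move=> Wx; rewrite halpha // eradius_sqr (sigma_frame W0 hsg) // (sq_dr Wx).
have t0 := lt0r_neq0 (t_gt0 Wx); have d0 := lt0r_neq0 (hmu' Wx).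
move: (sq x) => X; apply/matrixP => i j; rewrite !mxE.
by case: (i == j); rewrite ?mulr1n ?mulr0n; field; rewrite ?t0 ?d0.
Qed.

Let betaE x : W x -> beta x = (a * sqradius x) *: sigma sg 1 x.
Proof. by move=> /hbeta; rewrite eradius_sqr. Qed.

Let b2E x : W x -> sqnorm alpha2 beta x = a ^+ 2 * sqradius x.
Proof. exact: (sqnorm_beta n1 W0 hsg hmu' alphaE betaE). Qed.

Let D : set R := @sqradius R n @` W.
Let oD : open D. Proof. exact: open_sqradius. Qed.
Let iD : is_interval D. Proof. by apply: interval_sqradius; case: hW. Qed.

(** Read off from [alpha2] = 1 + mu/(1 - mu t) [sq x], b^2 = a^2 t and, locally, [beta] = a
    [rotation J x]. *)
Let P t : R := expR (rho (a ^+ 2 * t)) ^+ 2.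
Let Q t : R := P t * (mu / (1 - mu * t)).
Let S t : R := - (a ^+ 2 * kappa (a ^+ 2 * t)) * P t.
Let p := Profile P (derive1 P) (derive1 (derive1 P)) Q (derive1 Q) (derive1 (derive1 Q))
  S (derive1 S) (derive1 (derive1 S)).

Let B t : D t -> (sqnorm alpha2 beta @` W) (a ^+ 2 * t).
Proof. by move=> [x Wx <-]; exists x => //; rewrite b2E. Qed.

Let cscale j (E : set R) : open E -> Cn j E (fun t => a ^+ 2 * t).
Proof. by move=> oE; apply: CnM => //; [exact: Cn_cst | exact: Cn_id]. Qed.

Let cP j : Cn j D P.
Proof.
have c : Cn j D (fun t => expR (rho (a ^+ 2 * t))).
have cr : Cn j (sqnorm alpha2 beta @` W) rho by move/smooth1_onP: hrho.
  refine (Cn_expR oD (Cn_comp oD B cr (cscale _ oD))).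
have -> : P = (fun t => expR (rho (a ^+ 2 * t)) * expR (rho (a ^+ 2 * t))).
  by apply/funext => t; rewrite /P expr2.
exact: CnM.
Qed.

Let cQ j : Cn j D Q.
Proof.
refine (CnM oD (cP j) _); refine (CnM oD (Cn_cst oD _ _) _).
refine (CnV oD _ _); first by move=> _ [x Wx <-]; rewrite gt_eqF // hmu'.
have -> : (fun t => 1 - mu * t) = (fun t => 1 + - mu * t).
  by apply/funext => t; rewrite mulNr.
refine (CnD oD (Cn_cst oD _ _) (CnM oD (Cn_cst oD _ _) (Cn_id oD _))).
Qed.

Let cS j : Cn j D S.
Proof.
refine (CnM oD _ (cP j)).
have -> : (fun t => - (a ^+ 2 * kappa (a ^+ 2 * t))) = (fun t => - a ^+ 2 * kappa (a ^+ 2 * t)).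
  by apply/funext => t; rewrite mulNr.
have ck : Cn j (sqnorm alpha2 beta @` W) kappa by move/smooth1_onP: hkappa.
refine (CnM oD (Cn_cst oD _ _) (Cn_comp oD B ck (cscale _ oD))).
Qed.

Let P_gt0 t : 0 < P t. Proof. by rewrite exprn_gt0 // expR_gt0. Qed.

Let V_gt0 t : D t -> 0 < coefV p t.
Proof.
move=> [x Wx <-]; rewrite /coefV /= /Q; have d0 := hmu' Wx.
have -> : P (sqradius x) + sqradius x * (P (sqradius x) * (mu / (1 - mu * sqradius x)))
   = P (sqradius x) / (1 - mu * sqradius x).
  by field; rewrite gt_eqF.
by rewrite divr_gt0.
Qed.

Let U_gt0 t : D t -> 0 < coefU p t.
Proof.
move=> [x Wx <-]; rewrite /coefU /= /S; have := hDelta Wx; rewrite b2E // => d0.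
have -> : P (sqradius x) + sqradius x * (- (a ^+ 2 * kappa (a ^+ 2 * sqradius x)) * P (sqradius x))
   = P (sqradius x) * (1 - a ^+ 2 * sqradius x * kappa (a ^+ 2 * sqradius x)) by ring.
by rewrite mulr_gt0.
Qed.

Let pD : regular_profile p D.
Proof.
move=> t Dt; split; split; try by rewrite gt_eqF ?V_gt0 ?U_gt0.
- exact: is_derive_Cn (cP 0) Dt.
- exact: is_derive_Cn (cQ 0) Dt.
- exact: is_derive_Cn (cS 0) Dt.
- by have [_ c] := cP 1; exact (is_derive_Cn (k := 0) c Dt).
- by have [_ c] := cQ 1; exact (is_derive_Cn (k := 0) c Dt).
- by have [_ c] := cS 1; exact (is_derive_Cn (k := 0) c Dt).
Qed.

Let phi (r : R) : R := expR (rho (a ^+ 2 * r ^+ 2)) * r.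

Let phi_sqr (x : 'rV[R]_n) : phi (eradius x) ^+ 2 = warp p (sqradius x).
Proof. by rewrite /phi exprMn eradius_sqr /warp /= /P; ring. Qed.

Let phi_gt0 x : W x -> 0 < phi (eradius x).
Proof. by move=> Wx; rewrite mulr_gt0 ?expR_gt0 // eradius_gt0 // neq0. Qed.

Let phi_smooth : smooth1_on (@eradius R n @` W) phi.
Proof.
apply/smooth1_onP => j; have oI : open (@eradius R n @` W) by exact: open_eradius.
have cr : Cn j (sqnorm alpha2 beta @` W) rho by move/smooth1_onP: hrho.
have IB r : (@eradius R n @` W) r -> (sqnorm alpha2 beta @` W) (a ^+ 2 * (r * r)).
  by move=> [x Wx <-]; exists x => //; rewrite b2E // -eradius_sqr expr2.
have c2 : Cn j (@eradius R n @` W) (fun r => a ^+ 2 * (r * r)).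
  refine (CnM oI (Cn_cst oI _ _) (CnM oI (Cn_id oI _) (Cn_id oI _))).
have := CnM oI (Cn_expR oI (Cn_comp oI IB cr c2)) (Cn_id oI j).
by under eq_fun do rewrite -expr2.
Qed.

Let dphi x : W x -> is_derive (eradius x) 1 phi (derive1 phi (eradius x)).
Proof. by move=> Wx; apply: (is_derive_Cn ((smooth1_onP _ _).1 phi_smooth 0)); exists x. Qed.

(** Differentiate phi(r)^2 = warp(r^2). This converts [hreg] into [warp1] != 0 and radial
    derivatives into derivatives in t. *)
Let phi_dphi x : W x ->
  phi (eradius x) * derive1 phi (eradius x) = eradius x * warp1 p (sqradius x).
Proof.
move=> Wx; have Dt : D (sqradius x) by exists x.
have d1 := is_derive_expn 2 (dphi Wx).
have dw : is_derive (eradius x ^+ 2) 1 (warp p) (warp1 p (sqradius x)).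
  by rewrite eradius_sqr; exact (is_derive_warp pD Dt).
have d2 := is_derive_comp (is_derive_expn 2 (is_derive_id (eradius x) 1)) dw.
have e : (fun r => phi r ^+ 2) = (fun r => warp p (id r ^+ 2)).
  by apply/funext => r; rewrite /phi exprMn /warp /= /P; ring.
have : 2%:R * phi (eradius x) ^+ 2.-1 * derive1 phi (eradius x) =
    warp1 p (sqradius x) * (2%:R * id (eradius x) ^+ 2.-1 * 1).
  by rewrite -(@derive_val _ _ _ _ _ _ _ d1) -(@derive_val _ _ _ _ _ _ _ d2) e.
by rewrite /= !expr1; lra.
Qed.

Let warp1_neq0 t : D t -> warp1 p t != 0.
Proof.
move=> [x Wx <-]; apply: contra_neq (hreg Wx) => w0.
by apply: (mulfI (lt0r_neq0 (phi_gt0 Wx))); rewrite phi_dphi // w0 !mulr0.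
Qed.

Let Dpos t : D t ->
  [/\ 0 < t, 0 < coefP p t, 0 < coefV p t, 0 < coefU p t & warp1 p t != 0].
Proof.
move=> Dt; split; [|exact: P_gt0|exact: V_gt0|exact: U_gt0|exact: warp1_neq0].
by case: Dt => x Wx <-; exact: t_gt0.
Qed.

(** [J] may change with [x0], but [P], [Q] and [S] do not. *)
Let local_form x0 : W x0 -> exists O J,
  [/\ open O, O x0, O `<=` W, J^T = - J & J *m J^T = 1%:M /\
    forall x, O x -> sigma sg 1 x = (sqradius x)^-1 *: rotation J x /\
      alphabar2 x = radial_metric J P Q S x].
Proof.
move=> Wx0; have [Nb [J [oO Ox0 OW skew [orth bJ]]]] :=
  killing_rotation n1 a0 oW W0 hsg hmu' alphaE betaE hkilling Wx0.
exists Nb, J; split=> //; split=> // x Ox; have Wx := OW x Ox.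
have t0 := lt0r_neq0 (t_gt0 Wx); split.
  have := bJ x Ox; rewrite betaE // => e.
  have -> : rotation J x = a^-1 *: (a *: rotation J x) by rewrite scalerA mulVf // scale1r.
  rewrite -e; move: (sigma sg 1 x) {e} => s; rewrite !scalerA.
  set c := (X in X *: _); have -> : c = 1; last by rewrite scale1r.
  by rewrite /c; field; rewrite t0 a0.
rewrite halphabar // b2E // alphaE // bJ // sqZ /radial_metric -/(P _).
move: (sq x) (sq (rotation J x)) => X Z; apply/matrixP => i j; rewrite !mxE /Q /S.
by case: (i == j); rewrite ?mulr1n ?mulr0n; ring.
Qed.

Local Notation lam := ((2 * M - 1) * mubar).

(** At each point both sides of the Einstein equation are combinations of the same three independent
    tensors, so coefficients may be compared and the local [J] disappears. The constant is lam =
    (n-1) mubar with n = 2m. *)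
Lemma constant_ricci_profile : constant_ricci W alphabar2 mubar <->
  forall t, D t -> [/\ ric0 (2 * M) p t = lam * P t, ric1 (2 * M) p t = lam * Q t
    & ric2 (2 * M) p t = lam * S t].
Proof.
have nM : n%:R = 2 * M :> R by rewrite natrM.
have lamE : n.-1%:R * mubar = lam.
  have e : n.-1%:R + 1 = n%:R :> R by rewrite natr1 prednK.
  by rewrite -nM -e addrK.
have ricE x : W x -> exists J, [/\ J^T = - J, J *m J^T = 1%:M,
    alphabar2 x = radial_metric J P Q S x &
    (\matrix_(i, j) ricci alphabar2 i j x = (ric0 (2 * M) p (sqradius x))%:M +
      ric1 (2 * M) p (sqradius x) *: sq x + ric2 (2 * M) p (sqradius x) *: sq (rotation J x))].
  move=> Wx; have [Nb [J [oO Ox OW skew [orth h]]]] := local_form Wx.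
  exists J; split=> //; first by have [] := h x Ox.
  apply/matrixP => i j; rewrite mxE.
  have OD y : Nb y -> D (sqradius y) by move=> /OW Wy; exists y.
  have gE y : Nb y -> alphabar2 y = radial_metric J (coefP p) (coefQ p) (coefS p) y.
    by move=> /h[].
  rewrite (ricci_radial_metric skew orth i j oO Ox pD OD gE) nM -!sqE.
  by move: (sq x) (sq (rotation J x)) => X Y; rewrite !mxE mulr_natr.
split=> [hR t [x Wx <-]|h x Wx i j].
  have [J [skew orth gE rE]] := ricE x Wx.
  apply: (radial_tensor_inj skew orth n2 (neq0 Wx)); rewrite -rE.
  have -> : \matrix_(i, j) ricci alphabar2 i j x = lam *: alphabar2 x.
    by apply/matrixP => i j; rewrite !mxE hR // lamE.
  by rewrite gE /radial_metric !scalerDr scale_scalar_mx !scalerA.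
have [J [skew orth gE /matrixP/(_ i j)]] := ricE x Wx.
have [-> -> ->] := h (sqradius x) (ex_intro2 _ _ x Wx erefl).
rewrite mxE => ->; rewrite gE lamE /radial_metric.
by move: (sq x) (sq (rotation J x)) => X Y; rewrite !mxE; case: (i == j);
  rewrite ?mulr1n ?mulr0n; ring.
Qed.

(** By [sigma_frame_tail] the tail of the coframe is (1 - sq x/t - sq (Jx)/t)/t, so the right side
    is a radial tensor too and its coefficients are determined. *)
Lemma target_metric x (c1 cr d s : R) : W x ->
  alphabar2 x = cr *: sq (d *: dr x) + c1 *: sq (sigma sg 1 x)
    + s ^+ 2 *: \sum_(2 <= k < n) sq (sigma sg k x) <->
  [/\ s ^+ 2 = warp p (sqradius x), cr * d ^+ 2 = coefV p (sqradius x)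
    & c1 = fibre p (sqradius x)].
Proof.
move=> Wx; have [Nb [J [oO Ox OW skew [orth h]]]] := local_form Wx.
have [sE gE] := h x Ox; set t := sqradius x; have t0 : t != 0 := lt0r_neq0 (t_gt0 Wx).
have tail : \sum_(2 <= k < n) sq (sigma sg k x) =
    t^-1 *: (1%:M - t^-1 *: sq x - t^-1 *: sq (rotation J x)).
  apply: (scalerI t0); rewrite (sigma_frame_tail W0 hsg n1 Wx) -/t sE sqZ !scalerA.
  by rewrite divff // scale1r -/t; congr (_ - _ *: _); field.
have -> : cr *: sq (d *: dr x) + c1 *: sq (sigma sg 1 x)
    + s ^+ 2 *: \sum_(2 <= k < n) sq (sigma sg k x) =
  (s ^+ 2 / t)%:M + (cr * d ^+ 2 / t - s ^+ 2 / t ^+ 2) *: sq x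
   + (c1 / t ^+ 2 - s ^+ 2 / t ^+ 2) *: sq (rotation J x).
  rewrite tail sE (sqZ (dr x) d) (sq_dr Wx) (sqZ (rotation J x)) -/t.
  move: (sq x) (sq (rotation J x)) => X Y; apply/matrixP => i j; rewrite !mxE.
  by case: (i == j); rewrite ?mulr1n ?mulr0n; field.
rewrite gE /radial_metric -/t /warp /coefV /fibre /coefU /=; split.
  move=> /(radial_tensor_inj skew orth n2 (neq0 Wx))[-> -> ->].
  by split; field.
move=> [e1 e2 e3].
have -> : s ^+ 2 / t = P t by rewrite e1; field.
have -> : cr * d ^+ 2 / t - s ^+ 2 / t ^+ 2 = Q t by rewrite e2 e1; field.
by have -> : c1 / t ^+ 2 - s ^+ 2 / t ^+ 2 = S t by rewrite e3 e1; field.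
Qed.

Let M1 : M != 1. Proof. by rewrite pnatr_eq1. Qed.

Let D0 : D !=set0.
Proof. by case: hW => _ _ [x Wx] _; exists (sqradius x); exists x. Qed.

(** Pointwise algebra: f^2 is [num] over the radicand. The sigma_1 coefficient is equivalent to the
    value of the radicand, and, given it, the dr coefficient to the value of the slope. *)
Let f_equations x (E F e : R) (t := sqradius x) (q := a ^+ 2 * warp p t)
    (f := radial_f m a mubar E F e q) :
  W x -> e = 1 \/ e = -1 -> 0 < 1 + E * q -> 0 < radicand m a mubar E F q ->
  slope p t = 1 + E * q /\ radicand m a mubar E F q =
    (if E == 0 then q else q ^+ k.+1 * (1 + E * q)) * (a ^+ 2 * fibre p t) <->
  a ^+ 4 * f ^+ 2 * (eradius x * warp1 p t) ^+ 2 * warp p t = coefV p t /\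
  (1 + E * q)^-1 * (a ^+ 4 * warp p t * f ^+ 2)^-1 = fibre p t.
Proof.
move=> Wx he v0 rad0; have Dt : D t by exists x.
have [tp Pp Vp Up w1] := Dpos Dt.
have wp : 0 < warp p t by rewrite mulr_gt0.
have q0 : 0 < q by rewrite mulr_gt0 // exprn_even_gt0.
have Hp : 0 < fibre p t by rewrite mulr_gt0.
rewrite [(eradius x * _) ^+ 2]exprMn eradius_sqr -/t /f radial_f_sqr // /slope.
have qk : q ^+ k != 0 by rewrite expf_neq0 // gt_eqF.
set rad := radicand _ _ _ _ _ _ in rad0 *.
pose num : R := if E == 0 then 1 else q ^+ k.
have num0 : num != 0 by rewrite /num; case: ifP => // _; rewrite oner_eq0.
have -> : (if E == 0 then q else q ^+ k.+1 * (1 + E * q)) = num * q * (1 + E * q).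
  rewrite /num; case: eqVneq => [->|_]; first by rewrite mul0r addr0 !mulr1 mul1r.
  by rewrite exprS; ring.
rewrite -/num; have r0 := lt0r_neq0 rad0; have H0 := lt0r_neq0 Hp.
have w0 := lt0r_neq0 wp; have U0 := lt0r_neq0 Up; have V0 := lt0r_neq0 Vp.
have t0 := lt0r_neq0 tp; have vv := lt0r_neq0 v0.
have qE : q = a ^+ 2 * warp p t by [].
have HE : fibre p t = t * coefU p t by [].
clearbody rad num.
move: (1 + E * q) v0 vv => v v0 vv; rewrite qE HE {qk q0}.
have aw : warp1 p t ^+ 2 != 0 by rewrite expf_neq0.
split=> [[sl ->]|[eV eH]].
  have -> : warp1 p t ^+ 2 = v * (coefV p t * coefU p t) by rewrite -sl; field; rewrite V0 U0.
  by split; field; rewrite ?a0 ?num0 ?t0 ?w0 ?U0 ?V0 ?vv.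
have eR : rad = num * (a ^+ 2 * warp p t) * v * (a ^+ 2 * (t * coefU p t)).
  by rewrite -eH; field; rewrite ?a0 ?num0 ?r0 ?w0 ?vv.
split=> //; rewrite -eV eR.
by field; rewrite ?a0 ?num0 ?t0 ?w0 ?w1 ?U0 ?V0 ?vv.
Qed.

Theorem constant_ricci_deformation :
  constant_ricci W alphabar2 mubar <->
  exists E F e : R, (e = 1 \/ e = -1) /\
  exists phi : R -> R, reparametrization (@eradius R n @` W) phi /\
    forall x, W x ->
      let r := phi (eradius x) in
      let q := a ^+ 2 * r ^+ 2 in
      let f := radial_f m a mubar E F e q in
      [/\ 0 < 1 + E * q,
          0 < radicand m a mubar E F q
        & alphabar2 x =
            (a ^+ 4 * r ^+ 4 * f ^+ 2) *: sq (derive1 phi (eradius x) *: dr x)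
            + ((1 + E * q)^-1 * (a ^+ 4 * r ^+ 2 * f ^+ 2)^-1) *:
                sq (sigma sg 1 x)
            + r ^+ 2 *: \sum_(2 <= k < n) sq (sigma sg k x)].
Proof.
have Dw t (Dt : D t) : 0 < t /\ warp1 p t != 0 by have [] := Dpos Dt.
have ode := einstein_ode lam oD pD Dw M1.
have int := first_integrals k mubar a0 oD iD pD Dpos D0.
apply: (iff_trans constant_ricci_profile); apply: (iff_trans ode).
apply: (iff_trans int); split=> [[E [F h]]|[E [F [e [he [psi [[_ psi_gt0] h]]]]]]].
  (* The metric involves f through f^2, so the sign is taken to be +1. *)
  exists E, F, 1; split; first by left.
  exists phi; split.
    by split; [exact: phi_smooth | move=> _ [x Wx <-]; split; [exact: phi_gt0 | exact: hreg]].
  move=> x Wx; have Dt : D (sqradius x) by exists x.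
  have [tp Pp Vp Up w1] := Dpos Dt.
  have wp : 0 < warp p (sqradius x) by rewrite mulr_gt0.
  have Hp : 0 < fibre p (sqradius x) by rewrite mulr_gt0.
  have a2 : 0 < a ^+ 2 by rewrite exprn_even_gt0.
  cbv zeta; rewrite phi_sqr; set q := a ^+ 2 * _.
  have q0 : 0 < q by rewrite mulr_gt0.
  have [sl rE] := h _ Dt.
  have v0 : 0 < 1 + E * q.
    by rewrite -sl; apply: divr_gt0; [rewrite exprn_even_gt0 | exact: mulr_gt0].
  have rad0 : 0 < radicand m a mubar E F q.
    rewrite rE; apply: mulr_gt0; last exact: mulr_gt0.
    by case: ifP => // _; rewrite mulr_gt0 // exprn_gt0.
  have [e1 e2] := (f_equations Wx (or_introl erefl) v0 rad0).1 (conj sl rE).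
  split=> //; rewrite -[X in X *: \sum_(_ <= _ < _) _](phi_sqr x).
  apply/(target_metric _ _ _ _ Wx); split=> //.
  by move: e1; rewrite -/q -(phi_dphi Wx) -(phi_sqr x) => <-; ring.
exists E, F => t [x Wx <-].
(* The reparametrization is forced: the coefficient of the tail of the coframe fixes psi^2, and both
   functions are positive. *)
have psiE y : W y -> psi (eradius y) = phi (eradius y).
  move=> Wy; have [_ _ /(target_metric _ _ _ _ Wy)[e1 _ _]] := h y Wy.
  have [p0 _] : 0 < psi (eradius y) /\ derive1 psi (eradius y) != 0.
    by apply: psi_gt0; exists y.
  apply/eqP; rewrite -(eqrXn2 (n := 2)) ?ltW ?phi_gt0 //.
  by rewrite e1 phi_sqr.
(* The functions agree only on the set of radii; it is open, so their derivatives agree there as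
   well. *)
have dpsi : derive1 psi (eradius x) = derive1 phi (eradius x).
  have oI : open (@eradius R n @` W) by exact: open_eradius.
  rewrite !derive1E; apply: near_eq_derive; near=> r.
  have [y Wy <-] : (@eradius R n @` W) r.
    by near: r; apply: open_nbhs_nbhs; split=> //; exists x.
  exact: psiE.
have := h x Wx; cbv zeta; rewrite psiE // dpsi phi_sqr => -[v0 rad0].
rewrite -[X in X *: \sum_(_ <= _ < _) _](phi_sqr x).
move=> /(target_metric _ _ _ _ Wx)[_ e1 e2].
apply: (f_equations Wx he v0 rad0).2; split; last exact: e2.
rewrite -e1 -(phi_dphi Wx) -[X in _ * X = _](phi_sqr x); ring.
Unshelve. all: by end_near. Qed.

End Deformation.

Theorem theorem7p2 (R : realType) (m : nat) (hm : (2 <= m)%N)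
  (mu mubar a : R) (ha : a != 0)
  (W : set 'rV[R]_(2 * m)) (hW : region W)
  (sg : nat -> 'rV[R]_(2 * m) -> 'rV[R]_(2 * m)) (hsg : sphere_coframe W sg)
  (* alpha^2 = dr^2 / (1 - mu r^2) + r^2 (sigma_1^2 + ... + sigma_(n-1)^2) *)
  (alpha2 : 'rV[R]_(2 * m) -> 'M[R]_(2 * m))
  (hmu : forall x, W x -> 0 < 1 - mu * eradius x ^+ 2)
  (halpha : forall x, W x ->
     alpha2 x = (1 - mu * eradius x ^+ 2)^-1 *: sq (dr x)
       + eradius x ^+ 2 *: \sum_(1 <= k < 2 * m) sq (sigma sg k x))
  (halphaR : riemannian W alpha2)
  (halphaC : constant_sectional W alpha2 mu)
  (* beta = a r^2 sigma_1 *)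
  (beta : 'rV[R]_(2 * m) -> 'rV[R]_(2 * m))
  (hbeta : forall x, W x -> beta x = (a * eradius x ^+ 2) *: sigma sg 1 x)
  (hkilling : killing W alpha2 beta)
  (* here a^2 - mu b^2 = a^2 (1 - mu r^2) > 0 on W *)
  (ht : forall x, W x -> forall y : 'rV[R]_(2 * m),
     let b2 := sqnorm alpha2 beta x in
     t00 alpha2 beta x y + (a ^+ 2 - mu * b2) * inner alpha2 x y y
     + mu * (b2 * inner alpha2 x y y - ev (beta x) y ^+ 2)
     - mu / (a ^+ 2 - mu * b2) * s0 alpha2 beta x y ^+ 2 = 0)
  (rho kappa : R -> R)
  (hrho : smooth1_on (sqnorm alpha2 beta @` W) rho)
  (hkappa : smooth1_on (sqnorm alpha2 beta @` W) kappa)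
  (hDelta : forall x, W x ->
     0 < 1 - sqnorm alpha2 beta x * kappa (sqnorm alpha2 beta x))
  (* alphabar = e^rho sqrt (alpha^2 - kappa beta^2) *)
  (alphabar2 : 'rV[R]_(2 * m) -> 'M[R]_(2 * m))
  (halphabar : forall x, W x ->
     alphabar2 x = expR (rho (sqnorm alpha2 beta x)) ^+ 2 *:
       (alpha2 x - kappa (sqnorm alpha2 beta x) *: sq (beta x)))
  (* e^rho r, the square root of the coefficient of sigma_2^2 + ... +
     sigma_(n-1)^2, is a local coordinate; at its critical points f would be
     infinite, i.e. the radicand in f would vanish *)
  (hreg : forall x, W x ->
     derive1 (fun r : R => expR (rho (a ^+ 2 * r ^+ 2)) * r) (eradius x) != 0) :
  constant_ricci W alphabar2 mubar <->
  exists E F e : R, (e = 1 \/ e = -1) /\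
  exists phi : R -> R, reparametrization (@eradius R (2 * m) @` W) phi /\
    forall x, W x ->
      let r := phi (eradius x) in
      let q := a ^+ 2 * r ^+ 2 in
      let f := radial_f m a mubar E F e q in
      [/\ 0 < 1 + E * q,
          0 < radicand m a mubar E F q
        & alphabar2 x =
            (a ^+ 4 * r ^+ 4 * f ^+ 2) *: sq (derive1 phi (eradius x) *: dr x)
            + ((1 + E * q)^-1 * (a ^+ 4 * r ^+ 2 * f ^+ 2)^-1) *:
                sq (sigma sg 1 x)
            + r ^+ 2 *: \sum_(2 <= k < 2 * m) sq (sigma sg k x)].
Proof.
have [k mk] : exists k, m = k.+2 by exists m.-2; lia.
subst m.
exact: (constant_ricci_deformation _ ha hW hsg hmu halpha hbeta hkilling hrho hkappa
  hDelta halphabar hreg).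
Qed.
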